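(* Let $p$ be a prime, let $G$ be a finite $p$-group and let $N$ be a normal subgroup of $G$. Put $\mathbf{p}=p$ if $p$ is odd and $\mathbf{p}=4$ if $p=2$. (a) If $N$ is potent or $\gamma_p(N)=1$, then $\exp([G,G^{\varphi}])$ divides $\mathbf{p}\cdot\exp([G/N,(G/N)^{\varphi}])\cdot\exp(N)$. (b) If $p\geq 3$ and $\gamma_{p-2}(N)\leq N^p$, then $\exp([G,G^{\varphi}])$ divides $\exp([G/N,(G/N)^{\varphi}])\cdot\exp(N)$.
   Context: Conventions: $x^y=y^{-1}xy$ and $[x,y]=x^{-1}y^{-1}xy$. $\gamma_1(H)=H$ and $\gamma_{i+1}(H)=[\gamma_i(H),H]$ is the lower central series. For a group $H$ and $k\ge 1$, $H^{k}$ is the subgroup generated by all $k$-th powers of elements of $H$. $\exp(H)$ is the exponent of $H$. A finite $p$-group $H$ is potent if $\gamma_{p-1}(H)\leq H^p$ (for $p>2$) or $H'\leq H^4$ (for $p=2$). For a group $G$, let $\varphi:G\to G^{\varphi}$, $g\mapsto g^{\varphi}$, be an isomorphism onto a copy $G^{\varphi}$ of $G$, and define $\nu(G)$ to be the group generated by $G\cup G^{\varphi}$ (keeping all relations of $G$ and of $G^\varphi$) subject to the additional relations $[g_1,g_2^{\varphi}]^{g_3}=[g_1^{g_3},(g_2^{g_3})^{\varphi}]=[g_1,g_2^{\varphi}]^{g_3^{\varphi}}$ for all $g_1,g_2,g_3\in G$. The subgroup $[G,G^{\varphi}]=\langle [g,h^{\varphi}] : g,h\in G\rangle$ of $\nu(G)$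 is identified with the non-abelian tensor square $G\otimes G$ (the group generated by symbols $g\otimes h$, $g,h\in G$, subject to $gg_1\otimes h=(g^{g_1}\otimes h^{g_1})(g_1\otimes h)$ and $g\otimes hh_1=(g\otimes h_1)(g^{h_1}\otimes h^{h_1})$ for all $g,g_1,h,h_1\in G$) via $g\otimes h\mapsto[g,h^{\varphi}]$. Likewise $[G/N,(G/N)^{\varphi}]$ is the corresponding subgroup of $\nu(G/N)$. *)

(* Defs.v *)
From HB Require Import structures.
From mathcomp Require Import all_boot all_fingroup all_solvable.
From mathcomp Require Import boolp.

Set Implicit Arguments.
Unset Strict Implicit.
Unset Printing Implicit Defensive.

Local Open Scope group_scope.
Local Open Scope quotient_scope.

(* The group nu(H) of an arbitrary group H, by generators and relations.      *)
(* A word is a product of letters, [inl g] standing for g in H and [inr g]    *)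
(* for its copy g^phi.  Every letter has an inverse letter, so no formal      *)
(* inverses are needed: the monoid presented by the relations below is the    *)
(* group presented by them.                                                   *)

Section NuWords.
Variable H : groupType.

Definition nu_word := seq (H + H).

Implicit Types (g h k : H) (u v w : nu_word).

Definition word_comm g h : nu_word := [:: inl g^-1; inr h^-1; inl g; inr h].

Inductive nu_cong : nu_word -> nu_word -> Prop :=
| nu_cong_refl u : nu_cong u u
| nu_cong_sym u v : nu_cong u v -> nu_cong v u
| nu_cong_trans u v w : nu_cong u v -> nu_cong v w -> nu_cong u w
| nu_cong_cat u u' v v' :
    nu_cong u u' -> nu_cong v v' -> nu_cong (u ++ v) (u' ++ v')
| nu_cong_oneL : nu_cong [:: inl 1] [::]
| nu_cong_oneR : nu_cong [:: inr 1] [::]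
| nu_cong_mulL g h : nu_cong [:: inl g; inl h] [:: inl (g * h)]
| nu_cong_mulR g h : nu_cong [:: inr g; inr h] [:: inr (g * h)]
| nu_cong_actL g h k :
    nu_cong (inl k^-1 :: word_comm g h ++ [:: inl k])
            (word_comm (g ^ k) (h ^ k))
| nu_cong_actR g h k :
    nu_cong (inr k^-1 :: word_comm g h ++ [:: inr k])
            (word_comm (g ^ k) (h ^ k)).

Definition nu_congb : rel nu_word := fun u v => `[< nu_cong u v >].

Lemma nu_congb_refl : reflexive nu_congb.
Proof. by move=> u; apply/asboolP/nu_cong_refl. Qed.

Lemma nu_congb_sym : symmetric nu_congb.
Proof.
by move=> u v; apply/asboolP/asboolP => uv; apply: nu_cong_sym.
Qed.

Lemma nu_congb_trans : transitive nu_congb.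
Proof.
by move=> v u w /asboolP uv /asboolP vw; apply/asboolP/(nu_cong_trans uv).
Qed.

Definition nu_equiv : equiv_rel nu_word :=
  EquivRel nu_congb nu_congb_refl nu_congb_sym nu_congb_trans.

Definition nu : Type := {eq_quot nu_equiv}.

HB.instance Definition _ := Choice.on nu.
HB.instance Definition _ := Quotient.on nu.

Definition nu_class u : nu := \pi_nu u.
Definition word_of (x : nu) : nu_word := generic_quotient.repr x.

Lemma nu_classP u v : nu_cong u v <-> nu_class u = nu_class v.
Proof.
split=> [uv | /eqmodP /asboolP //].
by apply/eqmodP/asboolP.
Qed.

Lemma nu_word_ofK (x : nu) : nu_class (word_of x) = x.
Proof. exact: reprK. Qed.

Definition letter_inv (a : H + H) : H + H :=
  match a with inl g => inl g^-1 | inr g => inr g^-1 end.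

Definition word_inv u : nu_word := rev (map letter_inv u).

Definition nu_one : nu := nu_class [::].
Definition nu_mul (x y : nu) : nu := nu_class (word_of x ++ word_of y).
Definition nu_inv (x : nu) : nu := nu_class (word_inv (word_of x)).

Lemma nu_mul_class u v : nu_mul (nu_class u) (nu_class v) = nu_class (u ++ v).
Proof. by apply/nu_classP/nu_cong_cat; apply/nu_classP/nu_word_ofK. Qed.

Lemma word_invK : involutive word_inv.
Proof.
move=> u; rewrite /word_inv map_rev revK -map_comp -[RHS]map_id.
by apply: eq_map => -[] g /=; rewrite invgK.
Qed.

Lemma nu_cong_mulV u : nu_cong (u ++ word_inv u) [::].
Proof.
elim: u => [|a u IHu]; first exact: nu_cong_refl.
have aV : nu_cong ([:: a] ++ [:: letter_inv a]) [::].
  case: a => g /=.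
    apply: nu_cong_trans (nu_cong_mulL g g^-1) _.
    by rewrite mulgV; exact: nu_cong_oneL.
  apply: nu_cong_trans (nu_cong_mulR g g^-1) _.
  by rewrite mulgV; exact: nu_cong_oneR.
rewrite /word_inv map_cons rev_cons -cats1 -/(word_inv u) -cat1s.
rewrite -catA [u ++ _]catA.
apply: nu_cong_trans aV.
apply: nu_cong_cat; first exact: nu_cong_refl.
by rewrite -[X in nu_cong _ X]cat0s; apply: nu_cong_cat IHu (nu_cong_refl _).
Qed.

Lemma nu_mulA : associative nu_mul.
Proof.
move=> x y z; rewrite -(nu_word_ofK x) -(nu_word_ofK y) -(nu_word_ofK z).
by rewrite !nu_mul_class catA.
Qed.

Lemma nu_mul1 : left_id nu_one nu_mul.
Proof. by move=> x; rewrite -(nu_word_ofK x) nu_mul_class cat0s. Qed.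

Lemma nu_mulg1 : right_id nu_one nu_mul.
Proof. by move=> x; rewrite -(nu_word_ofK x) nu_mul_class cats0. Qed.

Lemma nu_mulV : left_inverse nu_one nu_inv nu_mul.
Proof.
move=> x; rewrite -{2}(nu_word_ofK x) nu_mul_class.
apply/nu_classP; rewrite -{2}(word_invK (word_of x)); exact: nu_cong_mulV.
Qed.

Lemma nu_mulgV : right_inverse nu_one nu_inv nu_mul.
Proof.
move=> x; rewrite -{1}(nu_word_ofK x) nu_mul_class.
by apply/nu_classP; exact: nu_cong_mulV.
Qed.

HB.instance Definition _ :=
  isGroup.Build nu nu_mulA nu_mul1 nu_mulg1 nu_mulV nu_mulgV.

Definition nuL g : nu := nu_class [:: inl g].
Definition nuR g : nu := nu_class [:: inr g].

Lemma nuLM : {morph nuL : g h / g * h}.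
Proof.
by move=> g h; rewrite [RHS]nu_mul_class; apply/esym/nu_classP/nu_cong_mulL.
Qed.

Lemma nuRM : {morph nuR : g h / g * h}.
Proof.
by move=> g h; rewrite [RHS]nu_mul_class; apply/esym/nu_classP/nu_cong_mulR.
Qed.

Lemma nuL1 : nuL 1 = 1. Proof. exact/nu_classP/nu_cong_oneL. Qed.
Lemma nuR1 : nuR 1 = 1. Proof. exact/nu_classP/nu_cong_oneR. Qed.

Lemma nuLV g : nuL g^-1 = (nuL g)^-1.
Proof. by apply: (mulgI (nuL g)); rewrite -nuLM !mulgV nuL1. Qed.

Lemma nuRV g : nuR g^-1 = (nuR g)^-1.
Proof. by apply: (mulgI (nuR g)); rewrite -nuRM !mulgV nuR1. Qed.

Lemma nu_class_cat u v : nu_class (u ++ v) = nu_class u * nu_class v.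
Proof. by rewrite [RHS]nu_mul_class. Qed.

Lemma nu_class_cons a u : nu_class (a :: u) = nu_class [:: a] * nu_class u.
Proof. by rewrite -nu_class_cat. Qed.

Lemma nu_class_comm g h : nu_class (word_comm g h) = [~ nuL g, nuR h].
Proof.
rewrite /commg /conjg -nuLV -nuRV /word_comm nu_class_cons.
rewrite (nu_class_cons _ [:: inl g; inr h]).
by rewrite (nu_class_cons _ [:: inr h]).
Qed.

Lemma nu_actL g h k : [~ nuL g, nuR h] ^ nuL k = [~ nuL (g ^ k), nuR (h ^ k)].
Proof.
rewrite -!nu_class_comm {1}/conjg -nuLV.
rewrite -(nu_class_cat (word_comm g h)) -nu_class_cons.
by apply/nu_classP; exact: nu_cong_actL.
Qed.

Lemma nu_actR g h k : [~ nuL g, nuR h] ^ nuR k = [~ nuL (g ^ k), nuR (h ^ k)].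
Proof.
rewrite -!nu_class_comm {1}/conjg -nuRV.
rewrite -(nu_class_cat (word_comm g h)) -nu_class_cons.
by apply/nu_classP; exact: nu_cong_actR.
Qed.

Lemma nu_universal (K : groupType) (a b : H -> K) :
    {morph a : g h / g * h} -> {morph b : g h / g * h} ->
    (forall g h k, [~ a g, b h] ^ a k = [~ a (g ^ k), b (h ^ k)]) ->
    (forall g h k, [~ a g, b h] ^ b k = [~ a (g ^ k), b (h ^ k)]) ->
  exists! f : nu -> K,
    [/\ {morph f : x y / x * y}, f \o nuL =1 a & f \o nuR =1 b].
Proof.
move=> aM bM actL actR.
have a1 : a 1 = 1 by apply: (mulgI (a 1)); rewrite -aM !mulg1.
have b1 : b 1 = 1 by apply: (mulgI (b 1)); rewrite -bM !mulg1.
have aV g : a g^-1 = (a g)^-1 by apply: (mulgI (a g)); rewrite -aM !mulgV.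
have bV g : b g^-1 = (b g)^-1 by apply: (mulgI (b g)); rewrite -bM !mulgV.
pose ev1 (c : H + H) := match c with inl g => a g | inr g => b g end.
pose ev u := foldr (fun c x => ev1 c * x) 1 u.
have ev_cat u v : ev (u ++ v) = ev u * ev v.
  by elim: u => [|c u IHu] /=; rewrite ?mul1g // IHu mulgA.
have ev_comm g h : ev (word_comm g h) = [~ a g, b h].
  by rewrite /= mulg1 aV bV.
have evP u v : nu_cong u v -> ev u = ev v.
  elim=> {u v}.
  - by [].
  - by [].
  - by move=> u v w _ -> _ ->.
  - by move=> u u' v v' _ uv _ uv'; rewrite !ev_cat uv uv'.
  - by rewrite /= a1 mulg1.
  - by rewrite /= b1 mulg1.
  - by move=> g h; rewrite /= !mulg1 aM.
  - by move=> g h; rewrite /= !mulg1 bM.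
  - move=> g h k; rewrite ev_comm -actL -ev_comm /conjg -cat1s !ev_cat.
    by rewrite /= !mulg1 aV.
  - move=> g h k; rewrite ev_comm -actR -ev_comm /conjg -cat1s !ev_cat.
    by rewrite /= !mulg1 bV.
have fE u : ev (word_of (nu_class u)) = ev u by apply/evP/nu_classP/nu_word_ofK.
exists (fun x => ev (word_of x)); split.
  split=> [x y|g|g].
  - by rewrite -(nu_word_ofK x) -(nu_word_ofK y) -nu_class_cat !fE ev_cat.
  - by rewrite /= /nuL fE /= mulg1.
  - by rewrite /= /nuR fE /= mulg1.
move=> f [fM fL fR]; apply/funext => x.
rewrite -{2}(nu_word_ofK x); elim: (word_of x) => [|c u IHu] /=.
  by apply/esym; apply: (mulgI (f 1)); rewrite -fM !mulg1.
rewrite -cat1s nu_class_cat fM -IHu; congr (_ * _).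
by case: c => g; [rewrite -[LHS]fL | rewrite -[LHS]fR].
Qed.

End NuWords.

Section Exponent.
Variable T : groupType.

Inductive generated (A : T -> Prop) : T -> Prop :=
| generated_in x : A x -> generated A x
| generated1 : generated A 1
| generatedM x y : generated A x -> generated A y -> generated A (x * y)
| generatedV x : generated A x -> generated A x^-1.

(* The exponent of a possibly infinite group (or subset) A: the least n > 0   *)
(* killing A, and 0 if there is none.                                         *)
Definition kills (A : T -> Prop) (n : nat) : bool :=
  `[< forall x, A x -> x ^+ n = 1 >].

Definition exponent_of (A : T -> Prop) : nat :=
  if pselect (exists n, (0 < n)%N && kills A n) is left ex then ex_minn ex
  else 0.

Lemma exponent_of_dvd (A : T -> Prop) (n : nat) :
  (exponent_of A %| n)%N <-> (forall x, A x -> x ^+ n = 1).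
Proof.
rewrite /exponent_of; case: pselect => [ex | nex].
  case: ex_minnP => e /andP[e_gt0 /asboolP eA] e_min; split=> [|nA].
    by case/dvdnP=> k -> x Ax; rewrite mulnC expgnA eA // expg1n.
  apply: contraT => e_ndvd; suff: e <= n %% e by rewrite leqNgt ltn_mod e_gt0.
  apply: e_min; rewrite lt0n e_ndvd; apply/asboolP => x Ax.
  have := nA x Ax.
  by rewrite {1}(divn_eq n e) expgnDr mulnC expgnA eA // expg1n mul1g.
rewrite dvd0n; split=> [/eqP-> // | nA].
apply: contraT => n0; case: nex; exists n.
by rewrite lt0n n0; apply/asboolP.
Qed.

End Exponent.

(* [H, H^phi] <= nu(H), i.e. the non-abelian tensor square of H. *)
Definition tensor_square (H : groupType) : nu H -> Prop :=
  generated (fun x => exists g h : H, x = [~ nuL g, nuR h]).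

(* exp([G, G^phi]) for a subgroup G of a finite group type. *)
Definition exp_tensor_square (gT : finGroupType) (G : {group gT}) : nat :=
  exponent_of (@tensor_square (subg_of G)).

Section Potent.
Variable gT : finGroupType.
Implicit Types H : {group gT}.

(* H^k; for a p-group 'Mho^i(H) is the case k = p ^ i. *)
Definition power_subgroup H (k : nat) : {set gT} := <<[set x ^+ k | x in H]>>.

Definition potent (p : nat) H : Prop :=
  p.-group H /\
  (if p == 2%N then H^`(1) \subset power_subgroup H 4
   else 'L_(p - 1)(H) \subset power_subgroup H p).

End Potent.

Definition bold_p (p : nat) : nat := if p == 2%N then 4 else p.

(* Main.v *)
From mathcomp Require Import all_boot all_fingroup all_solvable.
From mathcomp Require Import boolp zify.
Require Import Defs.

(* Let K = [N, G^phi][G, N^phi] be the kernel of the projection from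
   [G, G^phi] to [G/N, (G/N)^phi]; it suffices to bound the exponent of K.
   Put N_0 = G and N_s = gamma_s(N) for s > 0.  The subgroups
       D_s = [N_(s-1), N^phi][N, N_(s-1)^phi]
   satisfy D_1 = K and [D_i, D_j] <= D_(i+j), since an element of [G, G^phi]
   acts on [G, G^phi] as its image in G' does.  If a is the deep entry of a
   generator [a, b^phi] of D_s, then expanding [a^r, b^phi] by the
   Hall-Petrescu formula bounds the order of [a, b^phi] in terms of the order
   of a and of the exponents of the D_j with j > s.  By descending induction
   on s, if the exponent of N_s divides p^(E - floor(s/(p-1))) for all s > 0,
   then that of D_s divides p^(E - floor((s-1)/(p-1))), and that of K divides
   p^E.
   With exp(N) = p^k one may take E = k + 1 if gamma_p(N) = 1, E = k if N is
   potent and p is odd, and E = k + 2 if N is potent and p = 2.  In the potent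
   cases the bound on exp(N_s) holds because gamma_(s+p-2)(N) (respectively
   gamma_(s+1)(N) for s > 1, when p = 2) consists of p-th powers of elements
   of gamma_s(N).  Part (b) follows from the potent case with E = k. *)

Set Implicit Arguments.
Unset Strict Implicit.
Unset Printing Implicit Defensive.

Local Open Scope group_scope.

(** * Polynomial sequences and the Hall-Petrescu formula *)

Section GroupIdentities.
Variable T : groupType.
Implicit Types x y z : T.

Lemma conjg_mulRg x y : x ^ y = x * [~ x, y].
Proof. by rewrite mulKVg. Qed.

Lemma commMgJg x y z : [~ x * y, z] = [~ x, z] ^ y * [~ y, z].
Proof. by rewrite !commgEr conjgM mulgA -conjMg mulgK. Qed.

Lemma commgMJg x y z : [~ x, y * z] = [~ x, z] * [~ x, y] ^ z.
Proof. by rewrite !commgEl conjgM -mulgA -conjMg mulKVg. Qed.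

Lemma commVgJg x y : [~ x^-1, y] = ([~ x, y] ^ x^-1)^-1.
Proof. by apply/(mulgI ([~ x, y] ^ x^-1)); rewrite -commMgJg !mulgV comm1g. Qed.

Lemma Hall_Witt_groupType x y z :
  [~ x, y^-1, z] ^ y * [~ y, z^-1, x] ^ z * [~ z, x^-1, y] ^ x = 1.
Proof.
pose a x y z : T := x * z * y ^ x.
have conjRmul (u v : T) : u ^ v = [~ v, u^-1] * u.
  by rewrite commgEr invgK mulgVK.
have aux (u v w : T) : [~ u, v^-1, w] ^ v = (a u v w)^-1 * (a v w u).
  by rewrite commgEr conjMg -conjgM -conjRmul conjgE !invgM !mulgA.
by rewrite !aux; move: a {aux} => a; rewrite 2!mulgA !mulgK mulVg.
Qed.

End GroupIdentities.

Section GroupMaps.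
Variables (K L : groupType) (f : K -> L).
Hypothesis fM : {morph f : x y / x * y}.

Lemma morph_mul1 : f 1 = 1.
Proof. by apply: (mulgI (f 1)); rewrite -fM !mulg1. Qed.

Lemma morph_mulV x : f x^-1 = (f x)^-1.
Proof. by apply: (mulgI (f x)); rewrite -fM !mulgV morph_mul1. Qed.

Lemma morph_mulX x n : f (x ^+ n) = f x ^+ n.
Proof. by elim: n => [|n IHn]; rewrite ?morph_mul1 // !expgS fM IHn. Qed.

Lemma morph_mulJ x y : f (x ^ y) = f x ^ f y.
Proof. by rewrite /conjg !fM morph_mulV. Qed.

Lemma morph_mulR x y : f [~ x, y] = [~ f x, f y].
Proof. by rewrite /commg fM morph_mulV morph_mulJ. Qed.

End GroupMaps.

Section Subgroups.
Variable T : groupType.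
Implicit Types (A B : T -> Prop) (x y z : T).

Record is_subgroup A : Prop := IsSubgroup {
  subgroup1 : A 1;
  subgroupM : forall x y, A x -> A y -> A (x * y);
  subgroupV : forall x, A x -> A x^-1 }.

Lemma subgroupX A x n : is_subgroup A -> A x -> A (x ^+ n).
Proof.
move=> sA Ax; elim: n => [|n IHn]; first exact: subgroup1 sA.
by rewrite expgS; apply: (subgroupM sA).
Qed.

Lemma subgroup_generated A : is_subgroup (generated A).
Proof.
split; [exact: generated1 | by move=> *; apply: generatedM |].
by move=> *; apply: generatedV.
Qed.

Lemma is_subgroup1 : is_subgroup (fun x : T => x = 1).
Proof. by split=> // [x y -> -> | x ->]; rewrite ?mulg1 ?invg1. Qed.

Lemma generated_sub A B :
  is_subgroup B -> (forall x, A x -> B x) -> forall x, generated A x -> B x.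
Proof.
move=> sB sAB x; elim=> {x} [x /sAB //||x y _ Bx _ By|x _ Bx].
- exact: subgroup1 sB.
- exact: (subgroupM sB).
- exact: (subgroupV sB).
Qed.

Lemma generated_conj A z :
  (forall x, A x -> generated A (x ^ z)) ->
  forall x, generated A x -> generated A (x ^ z).
Proof.
move=> AJ x; elim=> {x} [x /AJ //||x y _ Ax _ Ay|x _ Ax].
- by rewrite conj1g; apply: generated1.
- by rewrite conjMg; apply: generatedM.
- by rewrite conjVg; apply: generatedV.
Qed.

End Subgroups.

Section HallPetrescu.
Variables (T : groupType) (F : nat -> T -> Prop).
Hypothesis F_sub : forall i, is_subgroup (F i).
Hypothesis F_anti : forall i x, F i.+1 x -> F i x.
Hypothesis F_comm : forall i j x y, F i x -> F j y -> F (i + j) [~ x, y].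

(* Elements acting on [F] like members of [F j]; they need not lie in [F 0]. *)
Definition shifts j z := forall i t, F i t -> F (i + j) [~ t, z].

(** Depth-[d] truncation of a polynomial sequence in the sense of Lazard and Leibman: for every
    [k <= d] the [k]-th multiplicative difference takes values in [A (i + k)]. *)
Fixpoint polyseq (A : nat -> T -> Prop) d i (g : nat -> T) : Prop :=
  (forall n, A i (g n)) /\
  if d is d'.+1 then polyseq A d' i.+1 (fun n => g n.+1 * (g n)^-1) else True.

Local Notation polyF := (polyseq F).
Local Notation polyS := (polyseq shifts).

Lemma F_leq i j x : i <= j -> F j x -> F i x.
Proof. by move/subnK <-; elim: (j - i) => // k IHk /F_anti. Qed.

Lemma polyseq_anti A d i g : (forall j x, A j.+1 x -> A j x) ->
  polyseq A d i.+1 g -> polyseq A d i g.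
Proof.
move=> A_anti; elim: d i g => [|d IHd] i g /= [gA dg]; split; auto.
Qed.

Lemma polyseqW A d i g : polyseq A d.+1 i g -> polyseq A d i g.
Proof. by elim: d i g => [|d IHd] i g /= [gA dg]; split; auto. Qed.

Lemma polyF_leq d i j g : i <= j -> polyF d j g -> polyF d i g.
Proof.
move/subnK <-; elim: (j - i) => // k IHk /polyseq_anti gj.
exact/IHk/gj/F_anti.
Qed.

Lemma polyFS d i g : polyF d i g -> polyS d i g.
Proof.
elim: d i g => [|d IHd] i g /= [gF dg]; split; auto;
  by move=> n j t Ft; apply: F_comm.
Qed.

(** Pascal's rule turns the difference of [c ^+ 'C(n, k)] into [c ^+ 'C(n, k.-1)], and for [k = 0]
    the difference is trivial. *)
Lemma polyF_bin d i k c :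
  F (i + k) c -> polyF d i (fun n => c ^+ 'C(n, k)).
Proof.
have FX j m x e : F (j + m) x -> F j (x ^+ e).
  by move=> Fm; apply: subgroupX => //; apply: F_leq Fm; apply: leq_addr.
elim: d i k c => [|d IHd] i k c Fc /=; split=> //;
  try by move=> n; apply: FX Fc.
case: k => [|k] in Fc *.
  rewrite (_ : (fun _ => _) = fun n => 1 ^+ 'C(n, 0)); last first.
    by apply/funext => n; rewrite !bin0 mulgV expg1n.
  by apply: IHd; apply: subgroup1.
under eq_fun do rewrite binS addnC expgnDr mulgK.
by apply: IHd; rewrite addSnnS.
Qed.

(** The Lazard-Leibman theorem. The three closures need a joint induction on the depth: the
    differences that arise are products of conjugates, and a conjugation is a multiplication by a
    commutator. The second entry of the commutator is only asked to shift [F], which admits elements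
    outside the filtration. *)
Lemma polyseq_closed d :
  [/\ forall i g h, polyF d i g -> polyF d i h ->
        polyF d i (fun n => g n * h n),
      forall i g, polyF d i g -> polyF d i (fun n => (g n)^-1) &
      forall i j g h, polyF d i g -> polyS d j h ->
        polyF d (i + j) (fun n => [~ g n, h n])].
Proof.
elim: d => [|d [IHM IHV IHR]] /=.
  split=> [i g h [gF _] [hF _] | i g [gF _] | i j g h [gF _] [hF _]];
    split=> // n; [exact: subgroupM | exact: subgroupV | exact: hF].
have IHJ i j g h : polyF d i g -> polyS d j h -> polyF d i (fun n => g n ^ h n).
  move=> gF hS; under eq_fun do rewrite conjg_mulRg.
  by apply: IHM => //; apply: polyF_leq (IHR _ _ _ _ gF hS); apply: leq_addr.
split.
- move=> i g h gF hF; have [g1 dg] := gF; have [h1 dh] := hF.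
  split=> [n|]; first exact: subgroupM.
  under eq_fun => n.
    rewrite (_ : _ * _ = g n.+1 * (g n)^-1 * (h n.+1 * (h n)^-1) ^ (g n)^-1).
      over.
    by rewrite conjgE invgM invgK !mulgA mulgVK.
  by apply: IHM => //; apply: IHJ dh (polyFS (IHV _ _ (polyseqW gF))).
- move=> i g gF; have [g1 dg] := gF; split=> [n|]; first exact: subgroupV.
  under eq_fun => n.
    rewrite (_ : _ * _ = (g n.+1 * (g n)^-1)^-1 ^ g n); first over.
    by rewrite conjgE invgM !invgK !mulgA mulVg mul1g.
  exact: IHJ (IHV _ _ dg) (polyFS (polyseqW gF)).
move=> i j g h gF hS; have [g1 dg] := gF; have [h1 dh] := hS.
have gF' := polyseqW gF; have hS' := polyseqW hS.
split=> [n|]; first exact: h1.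
(* Since [g n.+1 = u n * g n] and [h n.+1 = v n * h n], expanding the commutator lets [[~ g n, h n]]
   cancel. Up to conjugation, only commutators with an entry [u] or [v] remain, at least one level
   deeper. *)
pose u n := g n.+1 * (g n)^-1; pose v n := h n.+1 * (h n)^-1.
under eq_fun => n.
  rewrite (_ : _ * _ = ([~ u n, h n] * [~ u n, v n] ^ h n) ^ g n *
                       ([~ g n, v n] ^ h n) ^ [~ g n, h n]^-1); first over.
  have -> : g n.+1 = u n * g n by rewrite /u mulgVK.
  have -> : h n.+1 = v n * h n by rewrite /v mulgVK.
  rewrite commMgJg !commgMJg [(_ ^ _) ^ (_^-1)]conjgE invgK !mulgA.
  by [].
apply: (IHM).
  apply: (IHJ) (polyFS gF'); apply: (IHM).
    by rewrite -addSn; apply: (IHR).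
  apply: (IHJ) hS'; apply: (@polyF_leq _ _ (i.+1 + j.+1)); last exact: IHR.
  by rewrite addSn addnS ltnS leqnSn.
apply: (IHJ) (polyFS (IHV _ _ (IHR _ _ _ _ gF' hS'))).
by apply: (IHJ) hS'; rewrite -addnS; apply: (IHR).
Qed.

(** As long as the earlier values are trivial, the [k]-th difference at 0 is the value [g k]
    itself. *)
Lemma polyF_lead k i g :
  polyF k i g -> (forall n, n < k -> g n = 1) -> F (i + k) (g k).
Proof.
elim: k i g => [|k IHk] i g /= [gF dg] g0; first by rewrite addn0.
have := IHk _ _ dg; rewrite /= (g0 k) // invg1 mulg1 addSnnS; apply=> n lt_nk.
by rewrite !g0 ?mulgV // ltnW.
Qed.

(** A Taylor expansion: [g n] is a product of factors [c_k ^+ 'C(n, k)] with [c_k] in [F k]. At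
    [n = r] all factors after the first fall into [S]. *)
Lemma polyF_binomial_expansion g r (S : T -> Prop) :
    is_subgroup S -> (forall d, polyF d 0 g) -> g 0 = 1 ->
    (forall k c, 2 <= k -> F k c -> S (c ^+ 'C(r, k))) ->
  S (g 1%N ^- r * g r).
Proof.
move=> sS gF g0 binS.
(* [h] is the remainder once the factors with [k < m.+2] are divided out. It is trivial below
   [m.+2], so [m = r] leaves nothing at [r]. *)
suffices /(_ r) [h [hF h0 [s Ss gE]]] : forall m, exists h,
    [/\ forall d, polyF d 0 h, forall n, n < m.+2 -> h n = 1 &
        exists2 s, S s & g r = g 1%N ^+ r * s * h r].
  by rewrite gE (h0 r) ?ltnS ?leqnSn // mulg1 !mulgA mulVg mul1g.
have mulV_bin k c h d : F k c -> polyF d 0 h ->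
    polyF d 0 (fun n => (c ^+ 'C(n, k))^-1 * h n).
  have [IHM IHV _] := polyseq_closed d => Fc hF.
  by apply: IHM hF; apply: IHV; apply: polyF_bin.
have Fg1 : F 1%N (g 1%N).
  by apply: (polyF_lead (i := 0) (gF 1%N)) => -[].
elim=> [|m [h [hF h0 [s Ss gE]]]].
  exists (fun n => (g 1%N ^+ 'C(n, 1))^-1 * g n); split.
  - by move=> d; apply: mulV_bin.
  - by case=> [|[]] // _; rewrite ?g0 ?bin0n ?bin1 ?invg1 ?mulg1 ?mulVg.
  - by exists 1; rewrite ?mulg1 ?bin1 ?mulVKg //; apply: subgroup1.
have Fh : F m.+2 (h m.+2) by apply: (polyF_lead (hF _)).
exists (fun n => (h m.+2 ^+ 'C(n, m.+2))^-1 * h n); split.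
- by move=> d; apply: mulV_bin.
- move=> n; rewrite ltnS leq_eqVlt => /predU1P[-> | lt_nm].
    by rewrite binn expg1 mulVg.
  by rewrite (h0 n) // bin_small // invg1 mulg1.
exists (s * h m.+2 ^+ 'C(r, m.+2)).
  by apply: subgroupM => //; apply: binS.
by rewrite gE !mulgA mulgK.
Qed.

(* The sequence [n |-> x^-n (x t)^n] is polynomial, because its difference
   sequence is [n |-> t ^ (x^n)]. *)
Theorem Hall_Petrescu r x t (S : T -> Prop) :
    is_subgroup S -> shifts 1%N x -> F 1%N t ->
    (forall k c, 2 <= k -> F k c -> S (c ^+ 'C(r, k))) ->
  S (t ^- r * (x ^- r * (x * t) ^+ r)).
Proof.
move=> sS xS Ft binS.
have FJ i n y : F i y -> F i (y ^ (x ^+ n)).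
  move=> Fy; elim: n => [|n IHn]; first by rewrite conjg1.
  rewrite expgSr conjgM conjg_mulRg; apply: (subgroupM (F_sub _)) => //.
  by apply/F_anti; rewrite -addn1; apply: xS.
have shifts1 j : shifts j 1.
  by move=> i y _; rewrite commg1; apply: (subgroup1 (F_sub _)).
have x_poly d : polyS d 0 (fun n => x ^+ n).
  have xn n : shifts 0 (x ^+ n).
    move=> i y Fy; rewrite addn0 commgEl; apply: (subgroupM (F_sub _)).
      exact: (subgroupV (F_sub _)).
    exact: FJ.
  have poly_const e i z : shifts i z -> polyS e i (fun=> z).
    elim: e i z => [|e IHe] i z zS; split=> //.
    by under eq_fun do rewrite mulgV; apply: IHe.
  case: d => [|d]; split=> //; under eq_fun do rewrite expgS mulgK.
  exact: poly_const.
pose g n := x ^- n * (x * t) ^+ n.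
have dgE n : g n.+1 * (g n)^-1 = t ^ (x ^+ n).
  rewrite /g [in X in _ * X]invgM invgK [(x * t) ^+ _.+1]expgS [x ^+ _.+1]expgS.
  by rewrite conjgE invgM !mulgA mulgK mulgVK.
have gF n : F 0 (g n).
  elim: n => [|n IHn]; first by rewrite /g invg1 mulg1; apply: subgroup1.
  rewrite -(mulgVK (g n) (g n.+1)) dgE; apply: (subgroupM (F_sub _)) => //.
  exact/FJ/F_anti.
suffices g_poly d : polyF d 0 g.
  have g1 : g 1%N = t by rewrite /g !expg1 mulKg.
  rewrite -[in t ^- r]g1 -/(g r); apply: polyF_binomial_expansion => //.
  by rewrite /g invg1 mulg1.
(* Depth [d.+1] is proved instead, so that only the difference sequence [t * [~ t, x ^+ n]], at
   depth [d], has to be treated. *)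
apply: polyseqW; split=> //.
under eq_fun do rewrite dgE conjg_mulRg.
have [IHM _ IHR] := polyseq_closed d.
have t_poly : polyF d 1%N (fun=> t).
  rewrite (_ : (fun=> t) = fun n => t ^+ 'C(n, 0)); first exact: polyF_bin.
  by apply/funext => n; rewrite bin0 expg1.
apply: IHM => //.
by rewrite -[1%N]addn0; apply: IHR (x_poly d).
Qed.

End HallPetrescu.

(** * The group nu(H) *)

Section NuGroup.
Variable H : groupType.
Implicit Types (g h k : H) (x y z t u : nu H).

Local Notation T := (@tensor_square H).

Lemma nu_ind (P : nu H -> Prop) :
    P 1 -> (forall g x, P x -> P (nuL g * x)) ->
    (forall g x, P x -> P (nuR g * x)) ->
  forall x, P x.
Proof.
move=> P1 PL PR x; rewrite -(nu_word_ofK x); elim: (word_of x) => // a w IHw.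
by rewrite nu_class_cons; case: a => g; [apply: PL | apply: PR].
Qed.

Lemma nu_conj_closed (A : nu H -> Prop) :
    (forall g x, A x -> A (x ^ nuL g)) -> (forall g x, A x -> A (x ^ nuR g)) ->
  forall z x, A x -> A (x ^ z).
Proof.
move=> AL AR z; elim/nu_ind: z => [x|g z IHz x|g z IHz x].
- by rewrite conjg1.
- by move=> Ax; rewrite conjgM; apply/IHz/AL.
- by move=> Ax; rewrite conjgM; apply/IHz/AR.
Qed.

Lemma nuLX g n : nuL (g ^+ n) = nuL g ^+ n.
Proof. exact: (morph_mulX (@nuLM H)). Qed.

Lemma nuRX g n : nuR (g ^+ n) = nuR g ^+ n.
Proof. exact: (morph_mulX (@nuRM H)). Qed.

Lemma nuLJ g h : nuL (g ^ h) = nuL g ^ nuL h.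
Proof. exact: (morph_mulJ (@nuLM H)). Qed.

Lemma nuRJ g h : nuR (g ^ h) = nuR g ^ nuR h.
Proof. exact: (morph_mulJ (@nuRM H)). Qed.

Lemma nuLR g h : nuL [~ g, h] = [~ nuL g, nuL h].
Proof. exact: (morph_mulR (@nuLM H)). Qed.

Lemma nuRR g h : nuR [~ g, h] = [~ nuR g, nuR h].
Proof. exact: (morph_mulR (@nuRM H)). Qed.

Lemma tensor_square_conj z t : T t -> T (t ^ z).
Proof.
apply: nu_conj_closed z t => k t;
  apply: generated_conj => _ [g [h ->]]; apply: generated_in.
- by rewrite nu_actL; exists (g ^ k), (h ^ k).
- by rewrite nu_actR; exists (g ^ k), (h ^ k).
Qed.

Lemma tensor_square_conjLR k t : T t -> t ^ nuL k = t ^ nuR k.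
Proof.
elim=> {t} [_ [g [h ->]]||t u _ IHt _ IHu|t _ IHt].
- by rewrite nu_actL nu_actR.
- by rewrite !conj1g.
- by rewrite !conjMg IHt IHu.
- by rewrite !conjVg IHt.
Qed.

Lemma rho_subproof :
  exists f : nu H -> H, [/\ {morph f : x y / x * y}, forall g, f (nuL g) = g &
                            forall g, f (nuR g) = g].
Proof.
have [||||f [[fM fL fR] _]] := @nu_universal H H id id => //.
- by move=> g h k; rewrite conjRg.
- by move=> g h k; rewrite conjRg.
by exists f; split.
Qed.

(* On [H, H^phi] this is the derived map [g (x) h |-> [g, h]]. *)
Definition rho : nu H -> H := projT1 (cid rho_subproof).

Lemma rhoM : {morph rho : x y / x * y}.
Proof. by rewrite /rho; case: cid => f []. Qed.

Lemma rhoL g : rho (nuL g) = g.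
Proof. by rewrite /rho; case: cid => f []. Qed.

Lemma rhoR g : rho (nuR g) = g.
Proof. by rewrite /rho; case: cid => f []. Qed.

Lemma rho1 : rho 1 = 1.
Proof. exact: morph_mul1 rhoM. Qed.

Lemma rhoV x : rho x^-1 = (rho x)^-1.
Proof. exact: (morph_mulV rhoM). Qed.

Lemma rho_comm x y : rho [~ x, y] = [~ rho x, rho y].
Proof. exact: (morph_mulR rhoM). Qed.

(** Both copies of an element act alike on [H, H^phi], so in the action of [g, h^phi] every letter
    may be read in the first copy. *)
Lemma tensor_square_conj_rho t u : T t -> T u -> u ^ t = u ^ nuL (rho t).
Proof.
move=> Tt; elim: Tt u => {t} [_ [g [h ->]]||t t' Tt IHt _ IHt'|t Tt IHt] u Tu.
- have commE x y : [~ x, y] = x^-1 * (y^-1 * (x * y)) by [].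
  rewrite rho_comm rhoL rhoR nuLR !commE -!nuLV -!nuRV !conjgM.
  rewrite (tensor_square_conjLR h^-1); last exact: tensor_square_conj.
  by rewrite (tensor_square_conjLR h) //; do 3!apply: tensor_square_conj.
- by rewrite rho1 nuL1.
- by rewrite rhoM nuLM !conjgM IHt' ?IHt //; apply: tensor_square_conj.
- rewrite rhoV nuLV; apply: (conjg_inj t); rewrite conjgKV IHt ?conjgKV //.
  exact: tensor_square_conj.
Qed.

(** Conjugation by h^phi sends g to g t. Expanding [g^h, k^phi] once through this and once through
    g^h = g [g, h] gives two products with the same first factor, because t and [g, h] act alike on
    [g, k^phi]. *)
Lemma comm_tensor_gen g h k :
  [~ [~ nuL g, nuR h], nuR k] = [~ nuL [~ g, h], nuR k].
Proof.
set t := [~ nuL g, nuR h].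
have Tgk : T [~ nuL g, nuR k] by apply: generated_in; exists g, k.
have Tt : T t by apply: generated_in; exists g, h.
have rt : rho t = [~ g, h] by rewrite rho_comm rhoL rhoR.
have gh : g ^ h = g * [~ g, h] by rewrite conjg_mulRg.
have E1 : [~ nuL (g ^ h), nuR k] = [~ nuL g * t, nuR k].
  rewrite -conjg_mulRg -[k in LHS](conjgKV h) -nu_actR conjRg.
  by rewrite nuRJ nuRV conjgKV.
have /(mulgI _) <- // : [~ nuL g, nuR k] ^ t * [~ t, nuR k] =
    [~ nuL g, nuR k] ^ t * [~ nuL [~ g, h], nuR k].
rewrite -commMgJg -E1 gh nuLM commMgJg; congr (_ * _).
by rewrite tensor_square_conj_rho // rt.
Qed.

Lemma comm_tensorR t k : T t -> [~ t, nuR k] = [~ nuL (rho t), nuR k].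
Proof.
elim=> {t} [_ [g [h ->]]||t u Tt IHt Tu IHu|t Tt IHt].
- by rewrite comm_tensor_gen rho_comm rhoL rhoR.
- by rewrite rho1 nuL1 !comm1g.
- rewrite rhoM nuLM !commMgJg IHt IHu tensor_square_conj_rho //.
  by rewrite -IHt /commg; apply: (generatedM _ (tensor_square_conj _ _)) => //;
     apply: generatedV.
- rewrite rhoV nuLV !commVgJg IHt; congr (_^-1).
  rewrite tensor_square_conj_rho ?rhoV ?nuLV //; first exact: generatedV.
  by apply: generated_in; exists (rho t), k.
Qed.

Lemma comm_tensorL t k : T t -> [~ t, nuL k] = [~ nuL (rho t), nuR k].
Proof.
by move=> Tt; rewrite -comm_tensorR // !commgEl tensor_square_conjLR.
Qed.

Lemma comm_tensor t u : T t -> T u -> [~ t, u] = [~ nuL (rho t), nuR (rho u)].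
Proof.
by move=> Tt Tu; rewrite -comm_tensorL // !commgEl tensor_square_conj_rho.
Qed.

End NuGroup.

(** * Divisibility of binomial coefficients, and the exponents of the filtration D_s *)

Lemma dvdn_bin_prime_power p E s k : prime p -> 0 < s -> 1 < k ->
  p ^ (E - (s + k.-1).-1 %/ p.-1) %| 'C(p ^ (E - s.-1 %/ p.-1), k).
Proof.
move=> p_pr s_gt0 k_gt1; have p1_gt0 : 0 < p.-1 by have := prime_gt1 p_pr; lia.
set e := E - s.-1 %/ p.-1; set v := logn p k.
have k_gt0 : 0 < k by lia.
(* From [v * (p - 1) < p ^ v <= k]. The [v] factors [p] that ['C(p ^ e, k)] may lose are thus
   compensated by replacing [s] with [s + k.-1]. *)
have v_le : v * p.-1 <= k.-1.
  have: p ^ v %| k by apply: pfactor_dvdnn.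
  move/(dvdn_leq k_gt0); suff: v * p.-1 < p ^ v by lia.
  elim: {k k_gt1 k_gt0} v => // n IHn; rewrite expnS mulSn.
  have := prime_gt1 p_pr; nia.
have le_e : E - (s + k.-1).-1 %/ p.-1 <= e - v.
  rewrite -subnDA leq_sub2l // leq_divRL // mulnDl.
  by have := leq_trunc_div s.-1 p.-1; lia.
apply: dvdn_trans (dvdn_exp2l p le_e) _.
have [le_ev | lt_ve] := leqP e v.
  by rewrite (eqP (_ : e - v == 0)) ?subn_eq0 // dvd1n.
have: p ^ e %| k * 'C(p ^ e, k).
  have pe_gt0 : 0 < p ^ e by rewrite expn_gt0 prime_gt0.
  by rewrite -(prednK k_gt0) -(prednK pe_gt0) -mul_bin_diag dvdn_mulr.
have [m co_pm defk] := pfactor_coprime p_pr k_gt0; rewrite -/v in defk.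
rewrite -[in X in X %| _](subnK (ltnW lt_ve)) expnD {1}defk mulnAC.
by rewrite dvdn_pmul2r ?expn_gt0 ?prime_gt0 // Gauss_dvdr // coprimeXl.
Qed.

Section TensorFiltration.
Variables (H : groupType) (N : nat -> H -> Prop).
Hypothesis N_sub : forall i, is_subgroup (N i).
Hypothesis N_conj : forall i x g, N i x -> N i (x ^ g).
Hypothesis N_full : forall x, N 0 x.
Hypothesis N_anti : forall i x, N i.+1 x -> N i x.
Hypothesis N_comm : forall i j x y, N i x -> N j y -> N (i + j) [~ x, y].
Hypothesis N_gen : forall i x, 0 < i -> N i.+1 x ->
  generated (fun z => exists a b, [/\ N i a, N 1%N b & z = [~ a, b]]) x.

Local Notation T := (@tensor_square H).

(* [tensor_filtration 1] is the kernel [N, G^phi][G, N^phi], because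
   [N 0] is the whole group. *)
Definition tensor_filtration s : nu H -> Prop :=
  generated (fun x => exists a b,
    (N s.-1 a /\ N 1%N b \/ N 1%N a /\ N s.-1 b) /\ x = [~ nuL a, nuR b]).
Local Notation D := tensor_filtration.

Lemma tensor_filtration_sub s : is_subgroup (D s).
Proof. exact: subgroup_generated. Qed.
Local Notation D_sub := tensor_filtration_sub.

Lemma tensor_filtration_square s x : D s x -> T x.
Proof.
apply: generated_sub x; first exact: subgroup_generated.
by move=> x [a [b [_ ->]]]; apply: generated_in; exists a, b.
Qed.
Local Notation D_T := tensor_filtration_square.

Lemma tensor_filtration_conj s z x : D s x -> D s (x ^ z).
Proof.
have NJ a b k : (N s.-1 a /\ N 1%N b \/ N 1%N a /\ N s.-1 b) ->
    N s.-1 (a ^ k) /\ N 1%N (b ^ k) \/ N 1%N (a ^ k) /\ N s.-1 (b ^ k).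
  by case=> -[Na Nb]; [left | right]; split; apply: N_conj.
apply: nu_conj_closed z x => k x;
  apply: generated_conj => _ [a [b [Nab ->]]]; apply: generated_in;
  by rewrite ?nu_actL ?nu_actR; exists (a ^ k), (b ^ k); split; first exact: NJ.
Qed.
Local Notation D_conj := tensor_filtration_conj.

Lemma tensor_filtration_conjE s z x : D s (x ^ z) -> D s x.
Proof. by move/(D_conj z^-1); rewrite conjgK. Qed.

Lemma N_leq i j x : i <= j -> N j x -> N i x.
Proof. by move/subnK <-; elim: (j - i) => // k IHk /N_anti. Qed.

Lemma tensor_filtration_leq s s' x : s <= s' -> D s' x -> D s x.
Proof.
move=> le_ss'; apply: generated_sub x => [|_ [a [b [Nab ->]]]].
  exact: D_sub.
apply: generated_in; exists a, b; split=> //.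
have le1 : s.-1 <= s'.-1 by lia.
by case: Nab => -[Na Nb]; [left | right]; split=> //; apply: N_leq le1 _.
Qed.
Local Notation D_leq := tensor_filtration_leq.

Lemma rho_tensor_filtration s x : D s x -> N s (rho x).
Proof.
have sN : is_subgroup (fun x => N s (rho x)).
  split=> [|y z Ny Nz|y Ny]; rewrite ?rho1 ?rhoM ?rhoV.
  - exact: subgroup1.
  - exact: subgroupM.
  - exact: subgroupV.
apply: generated_sub sN _ x => _ [a [b [Nab ->]]]; rewrite rho_comm rhoL rhoR.
case: s Nab => [|s] // [][Na Nb]; last by rewrite -add1n; apply: N_comm.
by rewrite -addn1; apply: N_comm.
Qed.
Local Notation rho_D := rho_tensor_filtration.

(** Induction on [i]: for a = [c, n], the commutator [a, b^phi] equals [[c, n^phi], b^phi]. By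
    Hall-Witt it is governed by two others: [c, [n, b]^phi] up to inverses, covered by induction,
    and [[b^phi, c^-1], n^-phi], which is a generator of [D] with deep entry [b, c^-1]. *)
Lemma tensor_filtration_comm_gen i j a b :
  0 < i -> 0 < j -> N i a -> N j b -> D (i + j) [~ nuL a, nuR b].
Proof.
elim: i j a b => [//|[|i] IHi] j a b _ j_gt0 Na Nb.
  by apply: generated_in; exists a, b; split=> //; right.
move: a Na; have sA : is_subgroup (fun a => D (i.+2 + j) [~ nuL a, nuR b]).
  split=> [|x y Dx Dy|x Dx]; rewrite ?nuL1 ?nuLM ?nuLV.
  - by rewrite comm1g; apply: subgroup1 (D_sub _).
  - by rewrite commMgJg; apply: (subgroupM (D_sub _)) => //; apply: D_conj.
  - by rewrite commVgJg; apply: (subgroupV (D_sub _)); apply: D_conj.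
move=> a /N_gen-/(_ isT); apply: generated_sub sA _ a => _ [c [n [Nc Nn ->]]].
rewrite -comm_tensor_gen.
have := Hall_Witt_groupType (nuL c) (nuR n)^-1 (nuR b); rewrite invgK.
set u := [~ nuL c, nuR n, nuR b]; set v := [~ _, _, nuL c].
set w := [~ _, _, _].
have Dv : D (i.+2 + j) v.
  have -> : v = [~ nuL c, nuR [~ n^-1, b^-1]]^-1 by rewrite invgR nuRR !nuRV.
  apply: (subgroupV (D_sub _)).
  rewrite addSnnS; apply: IHi => //.
  by rewrite -add1n; apply: N_comm; apply: (subgroupV (N_sub _)).
have Dw : D (i.+2 + j) w.
  have Tbc : T [~ nuR b, (nuL c)^-1].
    rewrite -invgR; apply: generatedV; apply: generated_in.
    by exists c^-1, b; rewrite nuLV.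
  rewrite /w -nuRV comm_tensorR //; apply: generated_in.
  exists (rho [~ nuR b, (nuL c)^-1]), n^-1; split=> //; left; split.
    rewrite rho_comm rhoR rhoV rhoL (_ : _.-1 = j + i.+1)%N; last by lia.
    by apply: N_comm => //; apply: (subgroupV (N_sub _)).
  exact: (subgroupV (N_sub _)).
move=> uvw; apply: (@tensor_filtration_conjE _ (nuR n)^-1).
have -> : u ^ (nuR n)^-1 = (v ^ nuR b * w ^ nuL c)^-1.
  by apply: invg_inj; rewrite invgK; apply/mulg1_eq; rewrite -[RHS]uvw -!mulgA.
by apply/(subgroupV (D_sub _))/(subgroupM (D_sub _)); apply: D_conj.
Qed.

Lemma tensor_filtration_comm i j x y : D i x -> D j y -> D (i + j) [~ x, y].
Proof.
move=> Dx Dy; have [i0 | i_gt0] := posnP i.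
  rewrite i0 commgEr; apply: (subgroupM (D_sub _)) => //.
  by apply/D_conj/(subgroupV (D_sub _)).
have [j0 | j_gt0] := posnP j.
  rewrite j0 addn0 commgEl; apply: (subgroupM (D_sub _)); last exact: D_conj.
  exact: (subgroupV (D_sub _)).
rewrite (comm_tensor (D_T Dx) (D_T Dy)).
by apply: tensor_filtration_comm_gen => //; apply: rho_D.
Qed.

Section Exponent.
Variables (p E c : nat).
Hypothesis p_pr : prime p.
Hypothesis N_exp :
  forall s a, 0 < s -> N s a -> a ^+ (p ^ (E - s %/ p.-1)) = 1.
Hypothesis N_nil : forall a, N c a -> a = 1.

Lemma tensor_filtration_exp s x :
  0 < s -> D s x -> x ^+ (p ^ (E - s.-1 %/ p.-1)) = 1.
Proof.
have [k] := ubnP (c.+1 - s); elim: k s x => // k IHk s x lt_k s_gt0.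
have [lt_cs | le_sc] := ltnP c s.
  suffices D1 : forall y, D s y -> y = 1 by move/D1->; rewrite expg1n.
  apply: generated_sub (is_subgroup1 _) _ => _ [a [b [Nab ->]]].
  have N1 d : N s.-1 d -> d = 1 by move=> Nd; apply/N_nil/(N_leq _ Nd); lia.
  case: Nab => -[Na Nb]; first by rewrite (N1 a) // nuL1 comm1g.
  by rewrite (N1 b) // nuR1 commg1.
(* [F 1] is [D s]. For [j > 1] the term [F j] is strictly deeper, so the induction hypothesis bounds
   its exponent; [s > 0] gives the commutator inclusions. *)
set r := (p ^ _)%N; pose F j := D (s + j.-1).
have F_sub j : is_subgroup (F j) by apply: D_sub.
have F_anti j y : F j.+1 y -> F j y by apply: D_leq; lia.
have F_comm i j y z : F i y -> F j z -> F (i + j) [~ y, z].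
  move=> Fy Fz; apply: D_leq (tensor_filtration_comm Fy Fz); lia.
have F_bin j y : 1 < j -> F j y -> y ^+ 'C(r, j) = 1.
  move=> j_gt1 Fy; have /dvdnP[q ->] := dvdn_bin_prime_power E p_pr s_gt0 j_gt1.
  by rewrite mulnC expgnA IHk ?expg1n //; lia.
(* All correction terms vanish by [F_bin], so the conclusion reads (y t)^r = y^r t^r. *)
have HallF y t :
    shifts F 1%N y -> D s t -> t ^- r * (y ^- r * (y * t) ^+ r) = 1.
  move=> yS Dt.
  apply: (Hall_Petrescu F_sub F_anti F_comm (is_subgroup1 _)) => //.
  by rewrite /F addn0.
(* For [s = 1] one entry lies only in [N 0], the whole group, where no exponent bound is available.
   The entry in [N 1] is used in its place, hence the maximum. *)
pose m := maxn s.-1 1.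
have expr a : N m a -> a ^+ r = 1.
  move=> Na; have m_gt0 : 0 < m by rewrite leq_max orbT.
  have le_m : E - m %/ p.-1 <= E - s.-1 %/ p.-1.
    by rewrite leq_sub2l // leq_div2r // leq_maxl.
  by rewrite /r -(subnK le_m) expnD mulnC expgnA (N_exp m_gt0 Na) expg1n.
have shiftN a : N m a ->
    forall i t, F i t -> F (i + 1) [~ nuL (rho t), nuR a].
  move=> Na i t /rho_D Nt; apply: (@D_leq _ (s + i.-1 + m)); first by lia.
  by apply: tensor_filtration_comm_gen => //; lia.
(* Here a conjugated by b^phi is a t, so (a t)^r is a conjugate of a^r = 1, and additivity of r-th
   powers gives t^r = 1. *)
have genL a t :
    N m a -> D s t -> (exists b, t = [~ nuL a, nuR b]) -> t ^+ r = 1.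
  move=> Na Dt [b def_t].
  have aS : shifts F 1%N (nuL a).
    by move=> i u Fu; rewrite comm_tensorL; [apply: shiftN | apply: D_T Fu].
  have := HallF _ _ aS Dt.
  rewrite {2}def_t -conjg_mulRg -conjXg -nuLX expr // nuL1 invg1 conj1g !mulg1.
  by move/(congr1 invg); rewrite invgK invg1.
have genR a t :
    N m a -> D s t -> (exists b, t = [~ nuR a, nuL b]) -> t ^+ r = 1.
  move=> Na Dt [b def_t].
  have aS : shifts F 1%N (nuR a).
    by move=> i u Fu; rewrite comm_tensorR; [apply: shiftN | apply: D_T Fu].
  have := HallF _ _ aS Dt.
  rewrite {2}def_t -conjg_mulRg -conjXg -nuRX expr // nuR1 invg1 conj1g !mulg1.
  by move/(congr1 invg); rewrite invgK invg1.
(* Membership in [D s] is carried through the induction because [HallF] needs it for products. *)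
move=> Dx; suffices [] : D s x /\ x ^+ r = 1 by [].
elim: Dx => {x} [x [a [b [Nab def_x]]]||x y _ [Dx xr] _ [Dy yr]|x _ [Dx xr]].
- have Dx : D s x by apply: generated_in; exists a, b.
  split=> //; have [s1 | s_gt1] := leqP s 1.
    have [m1 s0] : m = 1%N /\ s.-1 = 0 by lia.
    case: Nab => -[Na Nb]; last by apply: (genL a); rewrite ?m1 //; exists b.
    apply: invg_inj; rewrite -expVgn invg1; apply: (genR b); rewrite ?m1 //.
      exact: (subgroupV (D_sub s)).
    by exists a; rewrite def_x invgR.
  have ms : m = s.-1 by lia.
  case: Nab => -[Na Nb]; first by apply: (genL a); rewrite ?ms //; exists b.
  apply: invg_inj; rewrite -expVgn invg1; apply: (genR b); rewrite ?ms //.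
    exact: (subgroupV (D_sub s)).
  by exists a; rewrite def_x invgR.
- by split; [apply: subgroup1 (D_sub s) | rewrite expg1n].
- split; first exact: (subgroupM (D_sub s)).
  have xS : shifts F 1%N x.
    by move=> i t Ft; apply: F_comm => //; rewrite /F addn0.
  by have := HallF _ _ xS Dy; rewrite xr yr !invg1 !mul1g.
- split; first exact: (subgroupV (D_sub s)).
  by rewrite expVgn xr invg1.
Qed.

End Exponent.
End TensorFiltration.

(** * Powers in the lower central series of a potent group *)

Section LowerCentralPowers.
Variables (gT : finGroupType) (N : {group gT}).
Implicit Types (A B G K M : {group gT}) (x y w z : gT).

Lemma three_subgroup_sub A B K M :
    A \subset 'N(M) -> B \subset 'N(M) -> K \subset 'N(M) ->
    [~: A, B, K] \subset M -> [~: B, K, A] \subset M -> [~: K, A, B] \subset M.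
Proof.
move=> nMA nMB nMK.
have trivE (C D F : {group gT}) :
    C \subset 'N(M) -> D \subset 'N(M) -> F \subset 'N(M) ->
    ([~: C, D, F] \subset M) = ([~: C / M, D / M, F / M] == 1).
  move=> nC nD nF; have nCD : [~: C, D] \subset 'N(M) by apply: comm_subG.
  by rewrite -!quotientR // -subG1 quotient_sub1 // comm_subG.
rewrite !trivE // => /eqP c1 /eqP c2; apply/eqP; exact: three_subgroup.
Qed.

Lemma lcn_comm i j : 0 < i -> 0 < j ->
  [~: 'L_i(N), 'L_j(N)] \subset 'L_(i + j)(N).
Proof.
elim: i j => // [] [|i] IHi j _; case: j => // j _.
  by rewrite commGC add1n.
have nL m k : 'L_k(N) \subset 'N('L_m(N)).
  exact: subset_trans (lcn_sub k N) (lcn_norm m N).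
have nLN m : N \subset 'N('L_m(N)) by apply: lcn_norm.
rewrite lcnSn.
apply: (@three_subgroup_sub N 'L_j.+1(N)%G 'L_i.+1(N)%G 'L_(i.+2 + j.+1)(N)%G);
  [exact: nLN | exact: nL | exact: nL | |].
  rewrite [[~: N, _]]commGC -lcnSn commGC addSnnS; exact: IHi.
rewrite [[~: 'L_j.+1(N), _]]commGC.
by apply: subset_trans (commSg N (IHi j.+1 _ _)) _ => //; rewrite addSn lcnSn.
Qed.

Lemma lcn_mem_comm i j x y : 0 < i -> 0 < j ->
  x \in 'L_i(N) -> y \in 'L_j(N) -> [~ x, y] \in 'L_(i + j)(N).
Proof.
by move=> i0 j0 Lx Ly; apply: (subsetP (lcn_comm i0 j0)); apply: mem_commg.
Qed.

Lemma lcn_is_subgroup i : is_subgroup (fun x => x \in 'L_i(N)).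
Proof.
by split=> [|x y|x]; [apply: group1 | apply: groupM | rewrite groupV].
Qed.

Lemma lcn_mem_leq i j x : i <= j -> x \in 'L_j(N) -> x \in 'L_i(N).
Proof. by move=> le_ij; apply/subsetP/lcn_sub_leq. Qed.

Lemma lcn_powers_norm s r : N \subset 'N(power_subgroup 'L_s(N) r).
Proof.
apply: norms_gen; apply/subsetP=> y Ny; rewrite inE.
apply/subsetP=> _ /imsetP[_ /imsetP[x Lx ->] ->].
apply/imsetP; exists (x ^ y); last by rewrite conjXg.
by rewrite memJ_norm // (subsetP (lcn_norm s N)).
Qed.

Lemma mem_power_subgroup s r x :
  x \in 'L_s(N) -> x ^+ r \in power_subgroup 'L_s(N) r.
Proof. by move=> Lx; apply: mem_gen; apply/imsetP; exists x. Qed.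

(** Hall-Petrescu applied to [x^r, y] = x^-r (x [x, y])^r, with the filtration gamma_(sk+1)(N). The
    [maxn] makes [F 0] equal to [F 1], the level of [[~ x, y]]. *)
Lemma comm_expg_lcn s r x y (S : {group gT}) :
    0 < s -> x \in 'L_s(N) -> y \in N -> [~ x, y] ^+ r \in S ->
    (forall k c, 1 < k -> c \in 'L_(s * k).+1(N) -> c ^+ 'C(r, k) \in S) ->
  [~ x ^+ r, y] \in S.
Proof.
move=> s_gt0 Lx Ny Sxy binS; pose F k z := z \in 'L_(s * maxn k 1).+1(N).
have FR i j u v e :
    F i u -> v \in 'L_e(N) -> s * j <= e -> 0 < e -> F (i + j) [~ u, v].
  move=> Lu Lv le_e e_gt0; apply: (@lcn_mem_leq _ ((s * maxn i 1).+1 + e)).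
    have: s * maxn (i + j) 1 <= s * maxn i 1 + s * j.
      by rewrite -mulnDr leq_mul2l; lia.
    by lia.
  exact: lcn_mem_comm.
have sS : is_subgroup (fun z => z \in S).
  by split=> [|u v|u]; [apply: group1 | apply: groupM | rewrite groupV].
have := @Hall_Petrescu _ F _ _ _ r x [~ x, y] _ sS.
rewrite -conjg_mulR -conjXg -commgEl groupMl ?groupV //; apply.
- by move=> i; apply: lcn_is_subgroup.
- by move=> i z; apply: lcn_mem_leq; rewrite ltnS leq_mul2l; lia.
- move=> i j u v Fu Fv; apply: FR Fu Fv _ _ => //.
  by rewrite leqW // leq_mul2l; lia.
- by move=> i u Fu; apply: FR Fu Lx _ _; rewrite ?muln1.
- by rewrite /F muln1 -addn1; apply: lcn_mem_comm; rewrite ?lcn1.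
- by move=> k z k_gt1; rewrite /F (maxn_idPl _) ?(ltnW k_gt1) //; apply: binS.
Qed.

(** Otherwise the image of [A] in [N / B] is nontrivial and contained in its commutator with
    [N / B], contrary to nilpotency. *)
Lemma sub_nilpotent_comm A B :
    nilpotent N -> A \subset N -> N \subset 'N(A) -> N \subset 'N(B) ->
  A \subset B <*> [~: A, N] -> A \subset B.
Proof.
move=> nilN sAN nAN nBN sAB.
have nBA := subset_trans sAN nBN.
have nBR : [~: A, N] \subset 'N(B).
  by apply: subset_trans nBA; rewrite commg_subl.
rewrite -quotient_sub1 // subG1; apply: contraT => ntA.
have nilNB := quotient_nil B nilN.
have := @nil_comm_properl _ _ _ (N / B) nilNB (quotientS B sAN) ntA.
rewrite subsetI subxx quotient_norms // => /(_ isT).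
rewrite properE -quotientR // => /andP[_ /negP[]] /=.
by rewrite quotientSK // -norm_joinEr.
Qed.

(** gamma_(m+1)(N) = [gamma_m(N), N] lies in the commutator of the [r]-th powers with [N], which is
    checked on generators modulo gamma_(m+2)(N); nilpotency then removes that last term. *)
Lemma lcn_sub_powers_step s m r (B : {group gT}) :
    nilpotent N -> N \subset 'N(B) -> 0 < m ->
    'L_m(N) \subset power_subgroup 'L_s(N) r ->
    (forall x y, x \in 'L_s(N) -> y \in N ->
       [~ x ^+ r, y] \in B <*> 'L_m.+2(N)) ->
  'L_m.+1(N) \subset B.
Proof.
case: m => // m nilN nBN _ sLP xrS.
apply: sub_nilpotent_comm; rewrite ?lcn_sub ?lcn_norm //.
have nSN : N \subset 'N(B <*> 'L_m.+3(N)) by rewrite normsY ?lcn_norm.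
rewrite lcnSn in xrS nSN *; apply: subset_trans (commSg N sLP) _.
have sXN : [set x ^+ r | x in 'L_s(N)] \subset N.
  apply/subsetP=> _ /imsetP[x Lx ->]; rewrite groupX //.
  exact: subsetP (lcn_sub s N) _ Lx.
rewrite -quotient_cents2 ?(subset_trans _ nSN) ?gen_subG //.
rewrite quotient_gen ?(subset_trans sXN) // gen_subG.
rewrite quotient_cents2 ?(subset_trans sXN) // gen_subG.
by apply/subsetP=> _ /imset2P[_ y /imsetP[x Lx ->] Ny ->]; apply: xrS.
Qed.

Lemma bin_prime_exp p k c (S : {group gT}) (L : {set gT}) :
    prime p -> 1 < k < p -> c \in L -> (forall x, x \in L -> x ^+ p \in S) ->
  c ^+ 'C(p, k) \in S.
Proof.
move=> p_pr /andP[k1 kp] Lc LS.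
have /dvdnP[q ->] : p %| 'C(p, k) by rewrite prime_dvd_bin // kp ltnW.
by rewrite mulnC expgnA groupX ?LS.
Qed.

(** Induction on [s]. In the expansion of [x^p, y] the terms with [1 < k < p] are p-th powers since
    p divides the binomial coefficient, and the term [k = p] is deep enough to be discarded by
    [lcn_sub_powers_step]. *)
Lemma potent_lcn_sub p : prime p -> 2 < p -> nilpotent N ->
    'L_p.-1(N) \subset power_subgroup N p ->
  forall s, 0 < s -> 'L_(s + p.-2)(N) \subset power_subgroup 'L_s(N) p.
Proof.
move=> p_pr p_gt2 nilN sLP; elim=> // -[_ _|s IHs _].
  by rewrite (_ : 1 + p.-2 = p.-1)%N //; lia.
rewrite addSn; apply: (@lcn_sub_powers_step s.+1 _ p <<_>>%G);
  rewrite ?lcn_powers_norm ?IHs //.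
move=> x y Lx Ny; apply: (@comm_expg_lcn s.+1 _ _ _ (_ <*> _)%G) => //.
  apply/(subsetP (joing_subl _ _))/mem_power_subgroup.
  by rewrite -[s.+2]addn1; apply: lcn_mem_comm; rewrite ?lcn1.
move=> k c k_gt1 Lc; have [lt_kp | lt_pk | k_p] := ltngtP k p.
- apply: (@bin_prime_exp p k c _ 'L_s.+2(N)); rewrite ?k_gt1 //.
    by apply: lcn_mem_leq Lc; nia.
  by move=> z Lz; apply/(subsetP (joing_subl _ _))/mem_power_subgroup.
- by rewrite bin_small ?group1.
rewrite k_p binn; apply/(subsetP (joing_subr _ _)).
by apply: lcn_mem_leq Lc; rewrite k_p; nia.
Qed.

(** The first case, [s = 2], comes from fourth powers in [N]; the later ones need only squares. *)
Lemma powerful_lcn_sub : nilpotent N -> N^`(1) \subset power_subgroup N 4 ->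
  forall s, 1 < s -> 'L_s.+1(N) \subset power_subgroup 'L_s(N) 2.
Proof.
move=> nilN sNP; elim=> // -[_ //|[_ _|s IHs _]].
  apply: (@lcn_sub_powers_step 1 2 4 <<_>>%G);
    rewrite ?lcn_powers_norm ?lcn1 //.
  move=> x y Nx Ny.
  have SL z : z \in 'L_2(N) ->
      z ^+ 2 \in <<[set x ^+ 2 | x in 'L_2(N)]>> <*> 'L_4(N).
    by move=> Lz; apply/(subsetP (joing_subl _ _))/mem_power_subgroup.
  apply: (@comm_expg_lcn 1 _ _ _ (_ <*> _)%G); rewrite ?lcn1 //.
    by rewrite (expgnA _ 2 2) groupX ?SL // mem_commg.
  (* ['C(4, 2) = 6] and ['C(4, 3) = 4] are even, and the term [k = 4] lies in ['L_5(N)], inside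
     ['L_4(N)]. *)
  move=> [|[|[|[|[|k]]]]] c // _ Lc.
  - by rewrite (expgnA _ 2 3) groupX ?SL //; apply: lcn_mem_leq Lc.
  - by rewrite (expgnA _ 2 2) groupX ?SL //; apply: lcn_mem_leq Lc.
  - by apply: (subsetP (joing_subr _ _)); apply: lcn_mem_leq Lc.
  - by rewrite bin_small ?group1.
apply: (@lcn_sub_powers_step s.+2 _ 2 <<_>>%G);
  rewrite ?lcn_powers_norm ?IHs //.
move=> x y Lx Ny; apply: (@comm_expg_lcn s.+2 _ _ _ (_ <*> _)%G) => //.
  apply/(subsetP (joing_subl _ _))/mem_power_subgroup.
  by rewrite -[s.+3]addn1; apply: lcn_mem_comm; rewrite ?lcn1.
move=> [|[|[|k]]] c // _ Lc; last by rewrite bin_small ?group1.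
by apply: (subsetP (joing_subr _ _)); apply: lcn_mem_leq Lc; lia.
Qed.

(** x^p w^p differs from (x w)^p by a product of p-th powers from deeper in the lower central
    series. Pushing this correction down until it vanishes turns any product of p-th powers into a
    single one. *)
Lemma power_subgroup_lcnP p s0 : nilpotent N -> 0 < s0 ->
    (forall s u k c, s0 <= s -> s <= u -> 1 < k -> c \in 'L_(u + k.-1 * s)(N) ->
       c ^+ 'C(p, k) \in power_subgroup 'L_u.+1(N) p) ->
  forall s z, s0 <= s -> z \in power_subgroup 'L_s(N) p ->
  exists2 x, x \in 'L_s(N) & z = x ^+ p.
Proof.
move=> nilN s0_gt0 binP s z le_s0s; have s_gt0 : 0 < s by lia.
suffices powM u w : s <= u -> w \in power_subgroup 'L_u(N) p ->
    forall x, x \in 'L_s(N) -> exists2 y, y \in 'L_s(N) & x ^+ p * w = y ^+ p.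
  by move=> Pz; have [y Ly] := powM s z (leqnn s) Pz 1 (group1 _);
     rewrite expg1n mul1g; exists y.
have /lcnP[c Lc1] := nilN.
have [k] := ubnP (c.+1 - u); elim: k u w => // k IHk u w lt_k le_su Pw.
have [lt_cu | le_uc] := ltnP c u.
  have Lu1 : 'L_u(N) = 1.
    by apply/trivgP; rewrite -Lc1; apply: lcn_sub_leq.
  move: Pw; rewrite /power_subgroup /= Lu1 imset_set1 expg1n genGid.
  move=> /set1P-> x Lx.
  by exists x; rewrite ?mulg1.
(* [W] collects the factors that can be absorbed into a p-th power. It is a group, so only the
   generators [w ^+ p] remain to be treated. *)
pose W := [set v | [forall (x | x \in 'L_s(N)),
                    exists (y | y \in 'L_s(N)), x ^+ p * v == y ^+ p]].
have WP v : reflect (forall x, x \in 'L_s(N) ->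
                       exists2 y, y \in 'L_s(N) & x ^+ p * v = y ^+ p)
                    (v \in W).
  rewrite inE; apply: (iffP forall_inP) => vW x Lx.
    by have /exists_inP[y Ly /eqP] := vW x Lx; exists y.
  by have [y Ly Exy] := vW x Lx; apply/exists_inP; exists y; rewrite ?Exy.
have gW : group_set W.
  apply/group_setP; split; first by apply/WP=> x Lx; exists x; rewrite ?mulg1.
  move=> v v' /WP Wv /WP Wv'; apply/WP=> x Lx; have [y Ly Exy] := Wv x Lx.
  by have [y' Ly' Eyy'] := Wv' y Ly; exists y'; rewrite // mulgA Exy.
apply/WP; move: w Pw; apply/subsetP; rewrite (gen_subG _ (Group gW)).
apply/subsetP=> _ /imsetP[w Lw ->]; apply/WP=> x Lx.
have Lxw : x * w \in 'L_s(N) by rewrite groupM // (lcn_mem_leq le_su).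
suffices Pw : (x * w) ^- p * (x ^+ p * w ^+ p) \in power_subgroup 'L_u.+1(N) p.
  have [||y Ly Ey] := IHk u.+1 _ _ _ Pw _ Lxw; [by lia | by lia |].
  by exists y; rewrite // -Ey mulKVg.
rewrite -groupV invMg invgK invMg -mulgA.
pose F i v := v \in 'L_(u + i.-1 * s)(N).
have FR i j v v' e :
    F i v -> v' \in 'L_e(N) -> s * j <= e -> 0 < e -> F (i + j) [~ v, v'].
  move=> Fv Lv' le_e e_gt0.
  by apply: lcn_mem_leq (lcn_mem_comm _ e_gt0 Fv Lv'); [nia | lia].
apply: (@Hall_Petrescu _ F _ _ _ p x w
          (fun v => v \in power_subgroup 'L_u.+1(N) p)).
- by move=> i; apply: lcn_is_subgroup.
- by move=> i v; apply: lcn_mem_leq; nia.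
- by move=> i j v v' Fv Fv'; apply: FR Fv Fv' _ _; nia.
- by split=> [|v v'|v]; [apply: group1 | apply: groupM | rewrite groupV].
- by move=> i v Fv; apply: FR Fv Lx _ _; rewrite ?muln1.
- by rewrite /F addn0.
- by move=> i v i_gt1; apply: binP.
Qed.

(** For [s >= p - 1] an element of gamma_s(N) is the p-th power of one of gamma_(s-p+2)(N), and
    lowering [s] by [p - 2] lowers the floor by at most 1. *)
Lemma potent_exp p E : prime p -> 2 < p -> nilpotent N ->
    'L_p.-1(N) \subset power_subgroup N p ->
    (forall a, a \in N -> a ^+ (p ^ E) = 1) ->
  forall s a, 0 < s -> a \in 'L_s(N) -> a ^+ (p ^ (E - s %/ p.-1)) = 1.
Proof.
move=> p_pr p_gt2 nilN potN expN s.
have sLP := potent_lcn_sub p_pr p_gt2 nilN potN.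
have [m] := ubnP s; elim: m s => // m IHm s lt_sm a s_gt0 La.
have [lt_sp | le_ps] := ltnP s p.-1.
  by rewrite divn_small // subn0 expN //; apply: subsetP (lcn_sub s N) _ La.
have [t def_s t_gt0] : exists2 t, s = (t + p.-2)%N & 0 < t.
  by exists (s - p.-2); lia.
have Pa : a \in power_subgroup 'L_t(N) p.
  by apply: (subsetP (sLP t t_gt0)); rewrite -def_s.
have binP s' u k c :
    1 <= s' -> s' <= u -> 1 < k -> c \in 'L_(u + k.-1 * s')(N) ->
    c ^+ 'C(p, k) \in power_subgroup 'L_u.+1(N) p.
  move=> s'_gt0 le_s'u k_gt1 Lc; have [lt_kp | lt_pk | k_p] := ltngtP k p.
  - apply: (@bin_prime_exp p k c <<_>>%G 'L_u.+1(N)); rewrite ?k_gt1 //.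
      by apply: lcn_mem_leq Lc; nia.
    exact: mem_power_subgroup.
  - by rewrite bin_small ?group1.
  rewrite k_p binn; apply: (subsetP (sLP u.+1 isT)); apply: lcn_mem_leq Lc.
  by rewrite k_p; nia.
have [x Lx ->] := power_subgroup_lcnP nilN (isT : 0 < 1) binP t_gt0 Pa.
have le_e : E - t %/ p.-1 <= (E - s %/ p.-1).+1.
  have: s %/ p.-1 <= (t + p.-1) %/ p.-1 by apply: leq_div2r; lia.
  by rewrite divnDr // divnn; lia.
rewrite -expgnA -expnS -(subnK le_e) expnD mulnC expgnA IHm ?expg1n //; lia.
Qed.

(** Here [p - 1 = 1], so the floor is [s] itself. Square roots one level up exist from gamma_3(N)
    on, while gamma_1(N) and gamma_2(N) use only the exponent of [N]; hence [E.+2]. *)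
Lemma powerful_exp E : nilpotent N -> N^`(1) \subset power_subgroup N 4 ->
    (forall a, a \in N -> a ^+ (2 ^ E) = 1) ->
  forall s a, 0 < s -> a \in 'L_s(N) -> a ^+ (2 ^ (E.+2 - s)) = 1.
Proof.
move=> nilN powN expN; have sLP := powerful_lcn_sub nilN powN.
have binP s u k c : 2 <= s -> s <= u -> 1 < k -> c \in 'L_(u + k.-1 * s)(N) ->
    c ^+ 'C(2, k) \in power_subgroup 'L_u.+1(N) 2.
  case: k => [|[|[|k]]] // s_gt1 le_su _ Lc; last by rewrite bin_small ?group1.
  apply: (subsetP (sLP u.+1 _)); first by lia.
  by apply: lcn_mem_leq Lc; lia.
have expL s a e : a \in 'L_s(N) -> E <= e -> a ^+ (2 ^ e) = 1.
  move=> La le_Ee; rewrite -(subnK le_Ee) expnD mulnC expgnA expN ?expg1n //.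
  exact: subsetP (lcn_sub s N) _ La.
elim=> // -[_ a _ La|[_ a _ La|s IHs a _ La]]; first by apply: expL La _; lia.
  by apply: expL La _; lia.
have Pa := subsetP (sLP s.+2 isT) _ La.
have [x Lx ->] :=
  power_subgroup_lcnP nilN (isT : 0 < 2) binP (isT : 1 < s.+2) Pa.
have le_e : E.+2 - s.+2 <= (E.+2 - s.+3).+1 by lia.
by rewrite -expgnA -expnS -(subnK le_e) expnD mulnC expgnA IHs ?expg1n.
Qed.

End LowerCentralPowers.

(** * The kernel of nu(G) -> nu(G/N) *)

Section NuQuotient.
Variables (H Q : groupType) (q : H -> Q) (N : nat -> H -> Prop).
Hypothesis qM : {morph q : g h / g * h}.
Hypothesis q_surj : forall y, exists g, q g = y.
Hypothesis N_sub : forall i, is_subgroup (N i).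
Hypothesis N_conj : forall i x g, N i x -> N i (x ^ g).
Hypothesis N_full : forall x, N 0 x.
Hypothesis N_ker : forall g h, q g = q h -> N 1%N (g^-1 * h).

Local Notation D := (tensor_filtration N 1).
Let D_sub : is_subgroup D := tensor_filtration_sub N 1.
Let D_conj z x : D x -> D (x ^ z).
Proof. exact: tensor_filtration_conj. Qed.

(** Including [D] among the generators makes the generated subgroup [R] normal without forming a
    normal closure. *)
Definition nu_ker_gen (z : nu H) : Prop :=
  (exists2 n, N 1%N n & z = nuL n \/ z = nuR n) \/ D z.
Local Notation R := (generated nu_ker_gen).

Let R_sub : is_subgroup R := subgroup_generated nu_ker_gen.

Lemma nu_ker_comm g h : N 1%N g \/ N 1%N h -> D [~ nuL g, nuR h].
Proof.
by move=> Ngh; apply: generated_in; exists g, h; split=> //; case: Ngh; auto.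
Qed.

Lemma nu_ker_conj z x : R x -> R (x ^ z).
Proof.
have RD y : D y -> R y by move=> Dy; apply: generated_in; right.
have RL n : N 1%N n -> R (nuL n).
  by move=> Nn; apply: generated_in; left; exists n; auto.
have RR n : N 1%N n -> R (nuR n).
  by move=> Nn; apply: generated_in; left; exists n; auto.
apply: nu_conj_closed z x => k x;
  apply: generated_conj => y [[n Nn [->|->]]|Dy]; try by apply/RD/D_conj.
- by rewrite -nuLJ; apply/RL/N_conj.
- rewrite conjg_mulRg -invgR; apply: (subgroupM R_sub); first exact: RR.
  by apply/(subgroupV R_sub)/RD/nu_ker_comm; right.
- rewrite conjg_mulRg; apply: (subgroupM R_sub); first exact: RL.
  by apply/RD/nu_ker_comm; left.
- by rewrite -nuRJ; apply/RR/N_conj.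
Qed.

Let eqR (x y : nu H) := R (x^-1 * y).

Let eqR_sym x y : eqR x y -> eqR y x.
Proof. by move/(subgroupV R_sub); rewrite invgM invgK. Qed.

Let eqR_trans x y z : eqR x y -> eqR y z -> eqR x z.
Proof. by move=> Rxy /(subgroupM R_sub Rxy); rewrite !mulgA mulgK. Qed.

Let eqR_mul x y x' y' : eqR x x' -> eqR y y' -> eqR (x * y) (x' * y').
Proof.
move=> Rx Ry; rewrite /eqR (_ : _ * _ = (x^-1 * x') ^ y * (y^-1 * y')).
  by apply: (subgroupM R_sub) => //; apply: nu_ker_conj.
by rewrite conjgE invgM !mulgA mulgK.
Qed.

Definition letter_map (a : H + H) : Q + Q :=
  match a with inl g => inl (q g) | inr g => inr (q g) end.
Local Notation wmap := (map letter_map).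

Lemma nu_class_lift_eq u v : wmap u = wmap v -> eqR (nu_class u) (nu_class v).
Proof.
elim: u v => [|a u IHu] [|b v] //=.
  by move=> _; rewrite /eqR mulVg; apply: subgroup1.
case=> ab /IHu uv; rewrite (nu_class_cons a) (nu_class_cons b).
apply: eqR_mul => //; case: a b ab => g [] h // [] /N_ker Ngh;
  apply: generated_in; left; exists (g^-1 * h) => //; [left | right].
  by rewrite nuLM nuLV.
by rewrite nuRM nuRV.
Qed.

(** Every defining relation of nu(Q) lifts to one of nu(H) through preimages of its letters, and two
    lifts of one word agree modulo [R]. Hence the kernel of nu(H) -> nu(Q) lies in [R]. *)
Lemma nu_cong_lift u v : nu_cong u v ->
  forall u' v', wmap u' = u -> wmap v' = v -> eqR (nu_class u') (nu_class v').
Proof.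
have [[q1 qV] qJ] := (morph_mul1 qM, morph_mulV qM, morph_mulJ qM).
have lift w : exists w', wmap w' = w.
  elim: w => [|[] y w [w' <-]]; first by exists [::].
    by have [g <-] := q_surj y; exists (inl g :: w').
  by have [g <-] := q_surj y; exists (inr g :: w').
have lift_cong u0 v0 u' v' :
    nu_cong u0 v0 -> wmap u' = wmap u0 -> wmap v' = wmap v0 ->
    eqR (nu_class u') (nu_class v').
  move=> /nu_classP uv /nu_class_lift_eq uu0 /nu_class_lift_eq/eqR_sym v0v.
  by apply: eqR_trans uu0 _; rewrite uv.
elim=> {u v}.
- by move=> u u' v' <- /esym; apply: nu_class_lift_eq.
- by move=> u v _ IH u' v' Eu Ev; apply/eqR_sym/IH.
- move=> u v w _ IHu _ IHw u' w' Eu Ew; have [v' Ev] := lift v.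
  exact: eqR_trans (IHu _ _ Eu Ev) (IHw _ _ Ev Ew).
- move=> u1 u2 v1 v2 _ IHu _ IHv w1 w2 E1 E2.
  have split_cat u v w : wmap w = u ++ v ->
      exists u' v', [/\ w = u' ++ v', wmap u' = u & wmap v' = v].
    move=> E; exists (take (size u) w), (drop (size u) w).
    by rewrite cat_take_drop map_take map_drop E take_size_cat ?drop_size_cat.
  have [x1 [y1 [-> Ex1 Ey1]]] := split_cat _ _ _ E1.
  have [x2 [y2 [-> Ex2 Ey2]]] := split_cat _ _ _ E2.
  by rewrite !nu_class_cat; apply: eqR_mul; [apply: IHu | apply: IHv].
- move=> u' v' Eu Ev; apply: (lift_cong _ _ _ _ (nu_cong_oneL H)) => //.
  by rewrite Eu /= q1.
- move=> u' v' Eu Ev; apply: (lift_cong _ _ _ _ (nu_cong_oneR H)) => //.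
  by rewrite Eu /= q1.
- move=> y z u' v' Eu Ev; have [[g Eg] [h Eh]] := (q_surj y, q_surj z).
  apply: (lift_cong _ _ _ _ (nu_cong_mulL g h)); first by rewrite Eu /= Eg Eh.
  by rewrite Ev /= qM Eg Eh.
- move=> y z u' v' Eu Ev; have [[g Eg] [h Eh]] := (q_surj y, q_surj z).
  apply: (lift_cong _ _ _ _ (nu_cong_mulR g h)); first by rewrite Eu /= Eg Eh.
  by rewrite Ev /= qM Eg Eh.
- move=> x y z u' v' Eu Ev.
  have [[g Eg] [h Eh]] := (q_surj x, q_surj y); have [k Ek] := q_surj z.
  apply: (lift_cong _ _ _ _ (nu_cong_actL g h k)).
    by rewrite Eu /= !qV Eg Eh Ek.
  by rewrite Ev /= !qV !qJ Eg Eh Ek.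
- move=> x y z u' v' Eu Ev.
  have [[g Eg] [h Eh]] := (q_surj x, q_surj y); have [k Ek] := q_surj z.
  apply: (lift_cong _ _ _ _ (nu_cong_actR g h k)).
    by rewrite Eu /= !qV Eg Eh Ek.
  by rewrite Ev /= !qV !qJ Eg Eh Ek.
Qed.

Lemma nu_ker_decomp z : R z ->
  exists n m t, [/\ N 1%N n, N 1%N m, D t & z = nuL n * nuR m * t].
Proof.
pose W z := exists n m t, [/\ N 1%N n, N 1%N m, D t & z = nuL n * nuR m * t].
have N1 : N 1%N 1 by apply: subgroup1.
have D1 : D 1 by apply: subgroup1.
have WL n : N 1%N n -> W (nuL n).
  by move=> Nn; exists n, 1, 1; rewrite nuR1 !mulg1.
have WR n : N 1%N n -> W (nuR n).
  by move=> Nn; exists 1, n, 1; rewrite nuL1 mul1g mulg1.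
have WD t : D t -> W t by move=> Dt; exists 1, 1, t; rewrite nuL1 nuR1 !mul1g.
have WM x y : W x -> W y -> W (x * y).
  move=> [n [m [t [Nn Nm Dt ->]]]] [n' [m' [t' [Nn' Nm' Dt' ->]]]].
  (* Collection to the left, using m t n' = n' m [m, n'] t^n' in nu(H). *)
  exists (n * n'), (m * m'), (([~ nuR m, nuL n'] * t ^ nuL n') ^ nuR m' * t').
  split; try by apply: (subgroupM (N_sub _)).
    apply: (subgroupM D_sub) => //; apply/D_conj/(subgroupM D_sub);
      last exact: D_conj.
    by rewrite -invgR; apply/(subgroupV D_sub)/nu_ker_comm; left.
  by rewrite nuLM nuRM -!mulgA !mulVKg.
have sW : is_subgroup W.
  split=> //; first exact: WD.
  move=> _ [n [m [t [Nn Nm Dt ->]]]]; rewrite !invgM -nuLV -nuRV.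
  apply: (WM _ _ (WD _ (subgroupV D_sub Dt))); apply: WM.
    by apply/WR/(subgroupV (N_sub _)).
  by apply/WL/(subgroupV (N_sub _)).
by apply: generated_sub sW _ z => z [[n Nn [->|->]]|]; auto.
Qed.

(** The two projections of nu(H) onto [H], each killing one copy, are trivial on [H, H^phi] and so
    on [D]. Applied to the decomposition of [z] they give [n = 1] and [m = 1]. *)
Lemma nu_ker_tensor z : tensor_square z -> R z -> D z.
Proof.
move=> Tz /nu_ker_decomp[n [m [t [Nn Nm Dt def_z]]]].
have kerT (f : nu H -> H) (a b : H -> H) : {morph f : x y / x * y} ->
    f \o @nuL H =1 a -> f \o @nuR H =1 b -> (forall g h, [~ a g, b h] = 1) ->
    forall u, tensor_square u -> f u = 1.
  move=> fM fL fR ab1.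
  have [f1 fV] := (morph_mul1 fM, morph_mulV fM).
  have sf : is_subgroup (fun u => f u = 1).
    by split=> // [x y fx fy|x fx]; rewrite ?fM ?fV ?fx ?fy ?mulg1 ?invg1.
  apply: generated_sub sf _ => _ [g [h ->]].
  by rewrite (morph_mulR fM) -(ab1 g h) -fL -fR.
have Tt : tensor_square t by apply: tensor_filtration_square Dt.
have n1 : n = 1.
  have [||||f [[fM fL fR] _]] := @nu_universal H H id (fun=> 1) => //.
  - by move=> *; rewrite mulg1.
  - by move=> *; rewrite !commg1 conj1g.
  - by move=> *; rewrite !commg1 conj1g.
  have kf := kerT _ _ _ fM fL fR (fun g _ => commg1 g).
  have := kf z Tz; rewrite def_z !fM (kf t) //.
  by rewrite (fL n : f _ = _) (fR m : f _ = _) !mulg1.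
have m1 : m = 1.
  have [||||f [[fM fL fR] _]] := @nu_universal H H (fun=> 1) id => //.
  - by move=> *; rewrite mulg1.
  - by move=> *; rewrite !comm1g conj1g.
  - by move=> *; rewrite !comm1g conj1g.
  have kf := kerT _ _ _ fM fL fR (fun _ => @comm1g _).
  have := kf z Tz; rewrite def_z !fM (kf t) //.
  by rewrite (fL n : f _ = _) (fR m : f _ = _) mulg1 mul1g.
by rewrite def_z n1 m1 nuL1 nuR1 !mul1g.
Qed.

(** The induced map nu(H) -> nu(Q) preserves tensor squares and therefore kills [x ^+ e], which thus
    lies in [R] and in [H, H^phi], hence in [D]. *)
Lemma tensor_square_quotient_exp e :
    (forall y : nu Q, tensor_square y -> y ^+ e = 1) ->
  forall x : nu H, tensor_square x -> D (x ^+ e).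
Proof.
move=> Qe x Tx.
have qJ := morph_mulJ qM.
have [||||f [[fM fL fR] _]] :=
  @nu_universal H (nu Q) (fun g => nuL (q g)) (fun g => nuR (q g)).
- by move=> g h; rewrite qM nuLM.
- by move=> g h; rewrite qM nuRM.
- by move=> g h k; rewrite nu_actL !qJ.
- by move=> g h k; rewrite nu_actR !qJ.
have [f1 fV] := (morph_mul1 fM, morph_mulV fM).
have fT : tensor_square (f x).
  elim: Tx => {x} [_ [g [h ->]]||x y _ Tx _ Ty|x _ Tx].
  - apply: generated_in; exists (q g), (q h).
    by rewrite (morph_mulR fM) (fL g : f _ = _) (fR h : f _ = _).
  - by rewrite f1; apply: generated1.
  - by rewrite fM; apply: generatedM.
  - by rewrite fV; apply: generatedV.
have f_class w : f (nu_class w) = nu_class (wmap w).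
  elim: w => [|a w IHw]; first exact: f1.
  rewrite nu_class_cons fM IHw /= (nu_class_cons (letter_map a)); congr (_ * _).
  by case: a => g; [apply: fL | apply: fR].
apply: nu_ker_tensor.
  by apply: subgroupX => //; apply: subgroup_generated.
have := Qe _ fT; rewrite -(morph_mulX fM) -{1}(nu_word_ofK (x ^+ e)) f_class.
move/(nu_classP _ [::])/nu_cong_sym/nu_cong_lift.
move/(_ [::] (word_of (x ^+ e)) erefl erefl).
by rewrite /eqR nu_word_ofK -/(1 : nu H) invg1 mul1g.
Qed.

End NuQuotient.

(** * Transfer to a normal subgroup of a finite group *)

Section FiniteGroup.
Variables (gT : finGroupType) (G N : {group gT}).
Hypothesis nNG : N <| G.

(** Index 0 is set apart because ['L_0(N)] is [N], whereas the filtration must start with all of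
    [G]. *)
Definition lcn_in i (x : subg_of G) : Prop :=
  if i is 0 then True else sgval x \in 'L_i(N).

Lemma lcn_in_generated i x : 0 < i -> lcn_in i.+1 x ->
  generated (fun z => exists a b, [/\ lcn_in i a, lcn_in 1 b & z = [~ a, b]]) x.
Proof.
case: i => // i _; set A := fun z => _.
have sNG := normal_sub nNG; have sLG := subset_trans (lcn_sub i.+1 N) sNG.
(* [K] turns the predicate into a subgroup of [G], which contains ['L_i.+2(N)] as soon as it
   contains the generating commutators. *)
pose K := [set z in G | `[< generated A (subg G z) >]].
have gK : group_set K.
  apply/group_setP; split.
    by rewrite inE group1; apply/asboolP; rewrite morph1; apply: generated1.
  move=> y z; rewrite !inE => /andP[Gy /asboolP Ay] /andP[Gz /asboolP Az].
  by rewrite groupM //; apply/asboolP; rewrite morphM //; apply: generatedM.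
have sLK : 'L_i.+2(N) \subset K.
  rewrite lcnSn (gen_subG _ (Group gK)).
  apply/subsetP=> _ /imset2P[a b La Nb ->].
  have [Ga Gb] := (subsetP sLG a La, subsetP sNG b Nb).
  rewrite inE groupR //; apply/asboolP; rewrite morphR //.
  by apply: generated_in; exists (subg G a), (subg G b); rewrite /= !subgK.
by move/(subsetP sLK); rewrite inE sgvalK => /andP[_ /asboolP].
Qed.

Lemma exp_tensor_square_dvd p E : prime p -> nilpotent N ->
    (forall s a, 0 < s -> a \in 'L_s(N) -> a ^+ (p ^ (E - s %/ p.-1)) = 1) ->
  exp_tensor_square G %| exp_tensor_square (G / N)%G * p ^ E.
Proof.
(* If [exponent_of] takes its default value 0 the equivalence [exponent_of_dvd] still holds, so the
   argument by powers of a single [x] covers that case. *)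
move=> p_pr nilN expN; apply/exponent_of_dvd => x Tx.
have sgM (g h : subg_of G) : sgval (g * h) = sgval g * sgval h by [].
have N_sub i : is_subgroup (lcn_in i).
  case: i => // i; split=> [|y z|y] /=; [exact: group1 | exact: groupM |].
  by rewrite groupV.
have N_conj i y g : lcn_in i y -> lcn_in i (y ^ g).
  case: i => // i Ly; have nLG : 'L_i.+1(N) <| G.
    exact: char_normal_trans (lcn_char _ _) nNG.
  rewrite -[lcn_in _ _]/(is_true (sgval y ^ sgval g \in 'L_i.+1(N))).
  rewrite memJ_norm //.
  exact: subsetP (normal_norm nLG) _ (subgP g).
have N_anti i y : lcn_in i.+1 y -> lcn_in i y.
  by case: i => // i; apply: (subsetP (lcn_subS i.+1 N)).
have N_comm i j y z : lcn_in i y -> lcn_in j z -> lcn_in (i + j) [~ y, z].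
  case: i j => [|i] [|j] // Ly Lz.
  - rewrite commgEr; apply: (subgroupM (N_sub _)) => //.
    by apply/N_conj/(subgroupV (N_sub _)).
  - rewrite addn0 commgEl; apply: (subgroupM (N_sub _)); last exact: N_conj.
    exact: (subgroupV (N_sub _)).
  by apply: (@lcn_mem_comm _ N i.+1 j.+1).
have [c Lc1] := lcnP _ nilN.
have N_nil a : lcn_in c.+1 a -> a = 1.
  by rewrite /= Lc1 => /set1P a1; apply: val_inj.
have N_exp s a : 0 < s -> lcn_in s a -> a ^+ (p ^ (E - s %/ p.-1)) = 1.
  move=> s_gt0 La; apply: (can_inj sgvalK).
  rewrite (morphX (sgval_morphism G)) ?inE // expN //.
  by case: s s_gt0 La.
pose q (g : subg_of G) := subg (G / N) (coset N (sgval g)).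
have nNg (g : subg_of G) : sgval g \in 'N(N).
  exact: subsetP (normal_norm nNG) _ (subgP g).
have Gq (g : subg_of G) : coset N (sgval g) \in G / N.
  exact: mem_quotient (subgP g).
have qM : {morph q : g h / g * h}.
  move=> g h; rewrite /q sgM (morphM _ (nNg g) (nNg h)).
  exact: (morphM (subg_morphism (G / N)) (Gq g) (Gq h)).
have q_surj y : exists g, q g = y.
  have /morphimP[g _ Gg def_y] := subgP y.
  by exists (subg G g); rewrite /q subgK // -[coset _ _]def_y sgvalK.
have N_ker g h : q g = q h -> lcn_in 1 (g^-1 * h).
  move/(congr1 sgval); rewrite !subgK // => Egh.
  rewrite -[lcn_in _ _]/(is_true ((sgval g)^-1 * sgval h \in N)).
  apply: coset_idr; first by rewrite groupM ?groupV ?nNg.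
  by rewrite morphM ?groupV ?nNg // morphV ?nNg //= Egh mulVg.
have Qe (y : nu (subg_of (G / N))) :
    tensor_square y -> y ^+ exp_tensor_square (G / N)%G = 1.
  by move: y; apply/exponent_of_dvd.
have Dx :=
  tensor_square_quotient_exp qM q_surj N_sub N_conj (fun=> I) N_ker Qe Tx.
rewrite expgnA.
(* At [s = 1] the floor is 0, so the bound on the kernel is exactly [p ^ E]. *)
have := tensor_filtration_exp N_sub N_conj (fun=> I) N_anti N_comm
  lcn_in_generated p_pr N_exp N_nil (isT : 0 < 1) Dx.
by rewrite div0n subn0.
Qed.

End FiniteGroup.

(** * The choice of E under each hypothesis on N *)

Theorem corollary4p4 (p : nat) (gT : finGroupType) (G N : {group gT})
    (p_pr : prime p) (pG : (p.-group G)%g) (nNG : (N <| G)%g) :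
  (potent p N \/ 'L_p(N)%g = 1%g ->
     exp_tensor_square G %|
       bold_p p * exp_tensor_square (G / N)%G * exponent N) /\
  (3 <= p -> 'L_(p - 2)(N)%g \subset power_subgroup N p ->
     exp_tensor_square G %|
       exp_tensor_square (G / N)%G * exponent N).
Proof.
have pN : p.-group N := pgroupS (normal_sub nNG) pG.
have nilN := pgroup_nil pN.
have [k expNE] : {k | exponent N = (p ^ k)%N}.
  by apply: p_natP; rewrite pnat_exponent.
have expN a : a \in N -> a ^+ (p ^ k) = 1.
  by rewrite -expNE; apply: expg_exponent.
have potent_case : 2 < p -> 'L_p.-1(N) \subset power_subgroup N p ->
    exp_tensor_square G %| exp_tensor_square (G / N)%G * exponent N.
  move=> p_gt2 potN; rewrite expNE; apply: exp_tensor_square_dvd => //.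
  exact: potent_exp.
have dvd_p E e : (p ^ E %| e * p ^ k)%N ->
    exp_tensor_square G %| exp_tensor_square (G / N)%G * p ^ E ->
    exp_tensor_square G %| e * exp_tensor_square (G / N)%G * exponent N.
  move=> dvdE /dvdn_trans; apply; rewrite expNE mulnAC mulnC.
  by rewrite dvdn_mul.
split=> [[[_ potN] | Lp1] | p_gt2 subN].
- have [p2 | p_neq2] := eqVneq p 2.
    move: potN; rewrite p2 /= => powN.
    (* The two extra factors 2 are those of [bold_p 2 = 4]. *)
    apply: (dvd_p k.+2); first by rewrite p2 /bold_p /= !expnS mulnA.
    apply: exp_tensor_square_dvd => // s a s_gt0 La.
    rewrite p2 divn1; apply: powerful_exp La => //.
    by rewrite p2 in expN.
  have p_gt2 : 2 < p by have := prime_gt1 p_pr; lia.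
  rewrite (negPf p_neq2) subn1 in potN.
  rewrite -mulnA dvdn_mull //; exact: potent_case.
(* For [s < p] the floor of s/(p-1) is at most 1, so one extra factor p suffices; for [s >= p] the
   group gamma_s(N) is trivial. *)
- apply: (dvd_p k.+1).
    rewrite expnS dvdn_mul // /bold_p; case: eqP => // ->.
    by [].
  apply: exp_tensor_square_dvd => // s a s_gt0 La.
  have Na : a \in N by apply: subsetP (lcn_sub s N) _ La.
  have p1_gt0 : 0 < p.-1 by have := prime_gt1 p_pr; lia.
  have [le_ps | lt_sp] := leqP p s.
    have: a \in 'L_p(N) by apply: lcn_mem_leq La.
    by rewrite Lp1 => /set1P->; rewrite expg1n.
  have le_k : k <= k.+1 - s %/ p.-1.
    have: s %/ p.-1 <= 1 by rewrite -ltnS ltn_divLR //; lia.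
    by lia.
  by rewrite -(subnK le_k) expnD mulnC expgnA expN ?expg1n.
(* gamma_(p-1)(N) is contained in gamma_(p-2)(N), so the odd potent case applies. *)
apply: potent_case => //; apply: subset_trans subN.
by apply: lcn_sub_leq; lia.
Qed.
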